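(* Let $(M,E,g)$ be a sub-Riemannian manifold with growth vector $(2,3,5)$, with $E$ trivializable and oriented. For an $E$-grading $I'$, written $TM=(TM)'_{-3}\oplus(TM)'_{-2}\oplus(TM)'_{-1}$ with $(TM)'_{-1}=E$, let $\theta$ be the unique one-form with $$\ker\theta=(TM)'_{-3}\oplus(TM)'_{-1},\qquad d\theta(u,v)=\langle u,Jv\rangle_g\ \text{ for all } u,v\in E,$$ and let $\Psi$ be the two-form $\Psi(v,w)=\langle J\varphi(v),\varphi(w)\rangle_g$ (with $J$ and $\varphi$ as defined in the context). Then there is a unique $E$-grading $I'$ such that (i) for any $u\in E=(TM)'_{-1}$ and $w_1,w_2\in(TM)'_{-3}$, $d\Psi(u,w_1,w_2)=0$; (ii) for any $u\in E$ and $w\in(TM)'_{-2}\oplus(TM)'_{-3}$, $d\theta(u,w)=0$.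
   Context: A sub-Riemannian manifold $(M,E,g)$ is a connected manifold $M$ with a subbundle $E\subseteq TM$ and a metric tensor $g$ on $E$. It has growth vector $(2,3,5)$ if $\dim M=5$, $E=E^{-1}$ has rank 2, $E^{-2}$ (spanned pointwise by sections of $E$ and brackets $[X,Y]$ of sections $X,Y$ of $E$) is a subbundle of rank 3, and sections of $E$ together with their iterated brackets of length at most 3 span $E^{-3}=TM$. An $E$-grading is a decomposition of $TM$ into subbundles $TM=(TM)'_{-3}\oplus(TM)'_{-2}\oplus(TM)'_{-1}$ with $(TM)'_{-1}=E$ and $(TM)'_{-2}\oplus E=E^{-2}$. $J:E\to E$ is the endomorphism such that for any unit vector $u\in E_x$, $x\in M$, the pair $u,Ju$ is a positively oriented orthonormal basis of $E_x$. The $E$-valued one-form $\varphi:TM\to E$ is defined by $\ker\varphi=E^{-2}$ and $\varphi([X,[X,JX]])=\|X\|_g^2\,JX$ for $X\in\Gamma(E)$; this is well defined since $-JX\mapsto\|X\|_g^{-2}[X,[X,JX]]\bmod E^{-2}$ is an invertible linear map from $E$ to $TM/E^{-2}$. The form $\Psi$ does not depend on the grading $I'$, whereas $\theta$ does. *)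

(* Defs.v *)
From HB Require Import structures.
From mathcomp Require Import all_boot all_order all_algebra.
From mathcomp Require Import all_classical all_reals all_analysis.
From mathcomp Require Import ring.

Set Implicit Arguments.
Unset Strict Implicit.
Unset Printing Implicit Defensive.

Import Order.TTheory GRing.Theory Num.Theory.
Import numFieldNormedType.Exports.

Local Open Scope classical_set_scope.
Local Open Scope ring_scope.

Section InfinitelyDifferentiable.
Context {R : realType} {V W : normedModType R}.
Implicit Types (U : set V) (f g : V -> W).

Fixpoint diff_upto (k : nat) U f : Prop :=
  if k is k'.+1 then
    (forall x, U x -> differentiable f x) /\
    (forall v, diff_upto k' U ('D_v f))
  else True.

(* C^oo: on the open set U, every iterated directional derivative of f is again
   differentiable (hence continuous).  Meant for open U only. *)
Definition smooth_on U f : Prop := forall k, diff_upto k U f.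

Lemma near0_differentiable f x : (\near x, f x = 0) -> differentiable f x.
Proof.
move=> f0.
have E : f \o shift x = cst (f x) + (\0 : {linear V -> W}) +o_ 0 id.
  apply/eqaddoP => _/posnumP[e].
  have : \forall y \near (0 : V), f (y + x) = 0.
    by move: f0; rewrite (near_shift 0) /= subr0.
  apply: filterS => y /= fy0.
  have -> : (f \o shift x - (cst (f x) + \0)) y = f (y + x) - (f x + 0) by [].
  by rewrite fy0 (nbhs_singleton f0) addr0 subr0 normr0 mulr_ge0.
have c0 : continuous (\0 : V -> W) by move=> y; exact: cvg_cst.
have d0 := diff_unique c0 E.
by apply/diff_locallyP; rewrite d0.
Qed.

Lemma near_eq_differentiable f g x :
  (\near x, f x = g x) -> differentiable f x -> differentiable g x.
Proof.
move=> fg df; have -> : g = f + (g - f) by rewrite addrC subrK.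
apply: differentiableD => //; apply: near0_differentiable.
by apply: filterS fg => y fgy; rewrite -[LHS]/(g y - f y) fgy subrr.
Qed.

Lemma diff_upto_congr k U f g :
  open U -> (forall x, U x -> f x = g x) -> diff_upto k U f -> diff_upto k U g.
Proof.
move=> oU; elim: k f g => [//|k IH] f g fg [df Df].
have near_fg x : U x -> \near x, f x = g x.
  by move=> Ux; apply: filterS (open_nbhs_nbhs (conj oU Ux)) => y /fg.
split=> [x Ux|v].
  by apply: near_eq_differentiable (df _ Ux); exact: near_fg.
apply: IH (Df v) => x Ux.
by apply: near_eq_derive; exact: near_fg.
Qed.

Lemma diff_upto_lin k U (a : R) f g :
  open U -> diff_upto k U f -> diff_upto k U g -> diff_upto k U (a *: f + g).
Proof.
move=> oU; elim: k f g => [//|k IH] f g [df Df] [dg Dg].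
split=> [x Ux|v].
  by apply: differentiableD; [apply: differentiableZ; apply: df | apply: dg].
apply: diff_upto_congr (IH _ _ (Df v) (Dg v)) => // x Ux.
have dfx : derivable f x v by apply: diff_derivable; exact: df.
have dgx : derivable g x v by apply: diff_derivable; exact: dg.
by rewrite deriveD ?deriveZ //; exact: derivableZ.
Qed.

Lemma diff_upto_cst k U (c : W) : diff_upto k U (cst c).
Proof.
elim: k c => [//|k IH] c; split=> [x _|v]; first exact: differentiable_cst.
suff -> : 'D_v (cst c) = cst 0 :> (V -> W) by exact: IH.
by apply/funext => x; exact: derive_cst.
Qed.

Lemma diff_uptoW k U f : diff_upto k.+1 U f -> diff_upto k U f.
Proof.
elim: k f => [//|k IH] f [df Df]; split=> // v; apply: IH; exact: Df.
Qed.

End InfinitelyDifferentiable.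

Lemma diff_upto_mul (R : realType) (V : normedModType R) k (U : set V)
    (f g : V -> R) :
  open U -> diff_upto k U f -> diff_upto k U g -> diff_upto k U (f * g).
Proof.
move=> oU; elim: k f g => [//|k IH] f g Hf Hg.
have [f' g'] := (diff_uptoW Hf, diff_uptoW Hg).
case: Hf Hg => [df Df] [dg Dg].
split=> [x Ux|v]; first by apply: differentiableM; [exact: df|exact: dg].
have := diff_upto_lin 1 oU (IH _ _ f' (Dg v)) (IH _ _ g' (Df v)).
apply: diff_upto_congr => // x Ux.
have dfx : derivable f x v by apply: diff_derivable; exact: df.
have dgx : derivable g x v by apply: diff_derivable; exact: dg.
by rewrite deriveM // scale1r.
Qed.


Section Manifolds.
Context {R : realType} {n : nat}.

Record chart (M : topologicalType) := Chart {
  chart_dom : set M;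
  chart_cod : set 'rV[R]_n;
  chart_map : M -> 'rV[R]_n;
  chart_inv : 'rV[R]_n -> M;
  chart_dom_open : open chart_dom;
  chart_cod_open : open chart_cod;
  chart_map_cod : forall p, chart_dom p -> chart_cod (chart_map p);
  chart_inv_dom : forall z, chart_cod z -> chart_dom (chart_inv z);
  chart_mapK : forall p, chart_dom p -> chart_inv (chart_map p) = p;
  chart_invK : forall z, chart_cod z -> chart_map (chart_inv z) = z;
  chart_map_continuous : {within chart_dom, continuous chart_map};
  chart_inv_continuous : {within chart_cod, continuous chart_inv} }.

Record manifold := Manifold {
  mfd_top :> topologicalType;
  mfd_hausdorff : hausdorff_space mfd_top;
  mfd_second_countable : @second_countable mfd_top;
  atlas : set (chart mfd_top);
  atlas_cover : forall p, exists2 c, atlas c & chart_dom c p;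
  atlas_compatible : forall c d, atlas c -> atlas d ->
    smooth_on (chart_cod c `&` [set z | chart_dom d (chart_inv c z)])
      (chart_map d \o chart_inv c) }.

End Manifolds.
Arguments manifold : clear implicits.
Arguments atlas {R n} m.

Section SmoothFunctions.
Context {R : realType} {n : nat} (M : manifold R n).

Definition smooth (f : M -> R) : Prop :=
  forall c, atlas M c -> smooth_on (chart_cod c) (f \o chart_inv c).

Definition smooth_pred : {pred M -> R} := fun f => `[< smooth f >].

Lemma smooth_predP f : reflect (smooth f) (f \in smooth_pred).
Proof. exact: asboolP. Qed.

Lemma smooth_lin (a : R) (f g : M -> R) :
  smooth f -> smooth g -> smooth (a *: f + g).
Proof.
move=> sf sg c Mc k; apply: (diff_upto_lin a _ (sf c Mc k) (sg c Mc k)).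
exact: chart_cod_open.
Qed.

Lemma smooth_mul (f g : M -> R) : smooth f -> smooth g -> smooth (f * g).
Proof.
move=> sf sg c Mc k; apply: (diff_upto_mul _ (sf c Mc k) (sg c Mc k)).
exact: chart_cod_open.
Qed.

Lemma smooth_cst (a : R) : smooth (cst a).
Proof. by move=> c _ k; exact: diff_upto_cst. Qed.

Fact smooth_submod_closed : submod_closed smooth_pred.
Proof.
split=> [|a f g /smooth_predP sf /smooth_predP sg]; apply/smooth_predP.
  exact: smooth_cst.
exact: smooth_lin.
Qed.

Fact smooth_mulr_closed : mulr_closed smooth_pred.
Proof.
split=> [|f g /smooth_predP sf /smooth_predP sg]; apply/smooth_predP.
  exact: smooth_cst.
exact: smooth_mul.
Qed.

HB.instance Definition _ :=
  GRing.isSubmodClosed.Build R (M -> R) smooth_pred smooth_submod_closed.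
HB.instance Definition _ :=
  GRing.isMulClosed.Build (M -> R) smooth_pred smooth_mulr_closed.

Record Cinf := MkCinf { Cinf_fun :> M -> R; _ : Cinf_fun \in smooth_pred }.
HB.instance Definition _ := [isSub for Cinf_fun].
HB.instance Definition _ := [Choice of Cinf by <:].
HB.instance Definition _ := [SubChoice_isSubZmodule of Cinf by <:].
HB.instance Definition _ := [SubZmodule_isSubLmodule of Cinf by <:].
HB.instance Definition _ :=
  GRing.SubZmodule_isSubPzRing.Build (M -> R) _ Cinf (subringClosedP _).
HB.instance Definition _ :=
  GRing.SubPzRing_isSubComPzRing.Build (M -> R) _ Cinf.

Definition derivation_at (x : M) : {pred Cinf -> R} := fun v => `[<
  scalar v /\ forall f g : Cinf, v (f * g) = f x * v g + g x * v f >].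

Fact derivation_at_submod_closed x : submod_closed (derivation_at x).
Proof.
split=> [|a v w /asboolP[linv Lv] /asboolP[linw Lw]]; apply/asboolP; split.
- by move=> b f g; rewrite /= mulr0 addr0.
- by move=> f g; rewrite /= !mulr0 addr0.
- move=> b f g; rewrite -[LHS]/(a * v (b *: f + g) + w (b *: f + g)).
  rewrite linv linw -[(a *: v + w) f]/(a * v f + w f).
  rewrite -[(a *: v + w) g]/(a * v g + w g) /=; ring.
- move=> f g; rewrite -[LHS]/(a * v (f * g) + w (f * g)).
  rewrite Lv Lw -[(a *: v + w) f]/(a * v f + w f).
  rewrite -[(a *: v + w) g]/(a * v g + w g) /=; ring.
Qed.
HB.instance Definition _ x :=
  GRing.isSubmodClosed.Build R (Cinf -> R) (derivation_at x)
    (derivation_at_submod_closed x).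

Record tangent (x : M) := Tangent {
  tangent_fun :> Cinf -> R; _ : tangent_fun \in derivation_at x }.
HB.instance Definition _ x := [isSub for @tangent_fun x].
HB.instance Definition _ x := [Choice of tangent x by <:].
HB.instance Definition _ x := [SubChoice_isSubZmodule of tangent x by <:].
HB.instance Definition _ x := [SubZmodule_isSubLmodule of tangent x by <:].

Lemma tangent_lin x (v : tangent x) : scalar v.
Proof. by case: v => v /= /asboolP[]. Qed.

Lemma tangent_leibniz x (v : tangent x) (f g : Cinf) :
  v (f * g) = f x * v g + g x * v f.
Proof. by case: v => v /= /asboolP[]. Qed.

Definition smooth_field (X : forall x, tangent x) : Prop :=
  forall f : Cinf, smooth (fun x => X x f).

Record vfield := VField {
  vfield_fun :> forall x, tangent x; vfieldP : smooth_field vfield_fun }.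

Definition vfield_act (X : vfield) (f : Cinf) : Cinf :=
  @MkCinf (fun x => X x f) (introT (smooth_predP _) (vfieldP X f)).

Definition bracket_fun (X Y : vfield) (x : M) (f : Cinf) : R :=
  X x (vfield_act Y f) - Y x (vfield_act X f).

Lemma vfield_act_lin (X : vfield) a f g :
  vfield_act X (a *: f + g) = a *: vfield_act X f + vfield_act X g.
Proof. by apply/val_inj/funext => x; exact: tangent_lin. Qed.

Lemma vfield_act_leibniz (X : vfield) f g :
  vfield_act X (f * g) = f * vfield_act X g + g * vfield_act X f.
Proof. by apply/val_inj/funext => x; exact: tangent_leibniz. Qed.

Lemma tangentD x (v : tangent x) f g : v (f + g) = v f + v g.
Proof. by have := tangent_lin v 1 f g; rewrite scale1r mul1r. Qed.

Fact bracket_derivation X Y x : bracket_fun X Y x \in derivation_at x.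
Proof.
apply/asboolP; split=> [a f g|f g]; rewrite /bracket_fun.
  by rewrite !vfield_act_lin !tangent_lin /=; ring.
rewrite !vfield_act_leibniz !tangentD !tangent_leibniz /=; ring.
Qed.

Fact bracket_smooth X Y : smooth_field (fun x => Tangent (bracket_derivation X Y x)).
Proof.
move=> f; pose h := vfield_act X (vfield_act Y f) - vfield_act Y (vfield_act X f).
by have /smooth_predP := valP h.
Qed.

Definition bracket (X Y : vfield) : vfield := VField (@bracket_smooth X Y).

End SmoothFunctions.

Arguments smooth_field {R n M} X.
Arguments vfield {R n} M.

Section LinearAlgebra.
Context {R : realType} {V : lmodType R}.

Definition is_subspace (D : set V) : Prop :=
  D 0 /\ forall (a : R) u v, D u -> D v -> D (a *: u + v).

Definition lspan (A : set V) : set V := smallest is_subspace A.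

Definition is_basis (D : set V) (k : nat) (e : 'I_k -> V) : Prop :=
  (forall v, D v <-> exists a : 'I_k -> R, v = \sum_i a i *: e i) /\
  (forall a : 'I_k -> R, \sum_i a i *: e i = 0 -> forall i, a i = 0).

Fact lspan_subspace (A : set V) : is_subspace (lspan A).
Proof.
split=> [B [[B0 _] _] //|a u v Au Av B BP]; have [[_ sB] _] := BP.
by apply: sB; [exact: Au|exact: Av].
Qed.

End LinearAlgebra.

Section Distributions.
Context {R : realType} {n : nat} (M : manifold R n).

Record subspace_field := SubspaceField {
  dist_set :> forall x : M, set (tangent x);
  dist_subspace : forall x, is_subspace (@dist_set x) }.

(* Local frames are taken to be restrictions of global vector fields; cutting
   off by a bump function and shrinking the neighbourhood shows that this is
   the usual notion. *)
Definition is_subbundle (D : subspace_field) (k : nat) : Prop :=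
  forall x : M, exists X : 'I_k -> vfield M,
    \forall y \near x, is_basis (@dist_set D y) (fun i => X i y).

Definition trivializable (D : subspace_field) : Prop :=
  exists (k : nat) (X : 'I_k -> vfield M),
    forall x : M, is_basis (@dist_set D x) (fun i => X i x).

Record gsection (D : subspace_field) := GSection {
  gsection_field :> vfield M;
  gsectionP : forall x : M, @dist_set D x (gsection_field x) }.

End Distributions.
Arguments subspace_field {R n} M.
Arguments SubspaceField {R n M} _ _.
Arguments dist_set {R n M} D x _ : rename.

Section SubRiemannian.
Context {R : realType} {n : nat} {M : manifold R n}.
Implicit Types (E : subspace_field M).

Definition dist2 E : subspace_field M :=
  SubspaceField
    (fun x => lspan ([set v | exists X : gsection E, v = X x] `|`
                     [set v | exists X Y : gsection E, v = bracket X Y x]))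
    (fun x => lspan_subspace _).

Definition dist3 E : subspace_field M :=
  SubspaceField
    (fun x => lspan
      ([set v | exists X : gsection E, v = X x] `|`
       [set v | exists X Y : gsection E, v = bracket X Y x] `|`
       [set v | exists X Y Z : gsection E, v = bracket X (bracket Y Z) x]))
    (fun x => lspan_subspace _).

(* A metric on E, and below an endomorphism of E, is given by a function on all
   tangent vectors, whose values off E are irrelevant. *)
Record metric E := Metric {
  metric_fun :> forall x : M, tangent x -> tangent x -> R;
  metric_lin : forall (x : M) (a : R) (u v w : tangent x),
    E x u -> E x v -> E x w ->
    metric_fun (a *: u + v) w = a * metric_fun u w + metric_fun v w;
  metric_sym : forall (x : M) (u v : tangent x), E x u -> E x v ->
    metric_fun u v = metric_fun v u;
  metric_pos : forall (x : M) (u : tangent x), E x u -> u != 0 ->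
    0 < metric_fun u u;
  metric_smooth : forall X Y : gsection E,
    smooth (fun x => metric_fun (X x) (Y x)) }.

(* An orientation of a bundle of rank two, as its set of positively oriented
   ordered bases: they form one class under change of basis with positive
   determinant (taking a singular change of basis shows that an oriented pair
   is linearly independent), and the class depends continuously on the point. *)
Record orientation E := Orientation {
  oriented_basis :> forall x : M, tangent x -> tangent x -> Prop;
  oriented_E : forall (x : M) (u v : tangent x),
    oriented_basis u v -> E x u /\ E x v;
  oriented_det : forall (x : M) (u v : tangent x) (a b c d : R),
    oriented_basis u v ->
    (oriented_basis (a *: u + b *: v) (c *: u + d *: v) <-> 0 < a * d - b * c);
  oriented_local : forall x : M, exists X Y : gsection E,
    \forall y \near x, oriented_basis (X y) (Y y) }.

Arguments metric_fun {E} g x _ _ : rename.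
Arguments oriented_basis {E} o x _ _ : rename.

Record rotation E (g : metric E) (o : orientation E) := Rotation {
  rot_fun :> forall x : M, tangent x -> tangent x;
  rot_lin : forall (x : M) (a : R) (u v : tangent x), E x u -> E x v ->
    rot_fun (a *: u + v) = a *: rot_fun u + rot_fun v;
  rot_E : forall (x : M) (u : tangent x), E x u -> E x (rot_fun u);
  rot_smooth : forall X : gsection E, smooth_field (fun x => rot_fun (X x));
  rot_unit : forall (x : M) (u : tangent x), E x u -> g x u u = 1 ->
    [/\ o x u (rot_fun u), g x u (rot_fun u) = 0
      & g x (rot_fun u) (rot_fun u) = 1] }.

Record eform E := EForm {
  eform_fun :> forall x : M, tangent x -> tangent x;
  eform_lin : forall x, linear (@eform_fun x);
  eform_E : forall (x : M) (v : tangent x), E x (eform_fun v);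
  eform_smooth : forall X : vfield M, smooth_field (fun x => eform_fun (X x)) }.

Record form1 := Form1 {
  form1_fun :> forall x : M, tangent x -> R;
  form1_lin : forall x, scalar (@form1_fun x);
  form1_smooth : forall X : vfield M, smooth (fun x => form1_fun (X x)) }.

Record form2 := Form2 {
  form2_fun :> forall x : M, tangent x -> tangent x -> R;
  form2_linl : forall (x : M) (w : tangent x),
    scalar (fun v : tangent x => form2_fun v w);
  form2_linr : forall (x : M) (v : tangent x),
    scalar (fun w : tangent x => form2_fun v w);
  form2_alt : forall (x : M) (v : tangent x), form2_fun v v = 0;
  form2_smooth : forall X Y : vfield M, smooth (fun x => form2_fun (X x) (Y x)) }.

Definition form1_app (a : form1) (X : vfield M) : Cinf M :=
  MkCinf (introT (smooth_predP _) (form1_smooth a X)).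

Definition form2_app (a : form2) (X Y : vfield M) : Cinf M :=
  MkCinf (introT (smooth_predP _) (form2_smooth a X Y)).

(* Exterior derivatives, by Koszul's formula and without a factor 1/2 or 1/3.
   Their value at x depends only on the values of the fields at x, so
   (d alpha)(u, v) is d1 alpha X Y x for any fields with X x = u, Y x = v. *)
Definition d1 (a : form1) (X Y : vfield M) : Cinf M :=
  vfield_act X (form1_app a Y) - vfield_act Y (form1_app a X)
  - form1_app a (bracket X Y).

Definition d2 (a : form2) (X Y Z : vfield M) : Cinf M :=
  vfield_act X (form2_app a Y Z) - vfield_act Y (form2_app a X Z)
  + vfield_act Z (form2_app a X Y)
  - form2_app a (bracket X Y) Z + form2_app a (bracket X Z) Y
  - form2_app a (bracket Y Z) X.

Arguments metric_fun {E} g x _ _ : rename.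
Arguments oriented_basis {E} o x _ _ : rename.
Arguments rot_fun {E g o} J x _ : rename.
Arguments eform_fun {E} phi x _ : rename.
Arguments form1_fun a x _ : rename.
Arguments form2_fun a x _ _ : rename.

Section Forms.
Context {E : subspace_field M} {g : metric E} {o : orientation E}.
Variables (J : rotation g o) (phi : eform E).

Definition rot_app (X : gsection E) : gsection E :=
  @GSection _ _ _ E (VField (rot_smooth J X))
    (fun x => rot_E J (gsectionP X x)).

Definition eform_app (X : vfield M) : gsection E :=
  @GSection _ _ _ E (VField (eform_smooth phi X)) (fun x => eform_E phi (X x)).

Definition is_phi : Prop :=
  (forall (x : M) (v : tangent x), phi x v = 0 <-> dist2 E x v) /\
  (forall (X : gsection E) (x : M),
     phi x (bracket X (bracket X (rot_app X)) x) =
     g x (X x) (X x) *: J x (X x)).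

Lemma dist0 x : E x 0. Proof. by case: (dist_subspace E x). Qed.

Lemma distZ x (a : R) u : E x u -> E x (a *: u).
Proof.
by move=> Eu; rewrite -[_ *: _]addr0; apply: (dist_subspace E x).2 => //;
  exact: dist0.
Qed.

Lemma metric0l x w : E x w -> g x 0 w = 0.
Proof.
move=> Ew; have := metric_lin g (-1) (dist0 x) (dist0 x) Ew.
by rewrite scaler0 addr0 mulN1r addNr.
Qed.

Lemma metric_linr x (a : R) u v w : E x u -> E x v -> E x w ->
  g x w (a *: u + v) = a * g x w u + g x w v.
Proof.
move=> Eu Ev Ew; rewrite metric_sym ?metric_lin ?(metric_sym _ Ew) //.
exact: (dist_subspace E x).2.
Qed.

Lemma metricZ x (a b : R) u v : E x u -> E x v ->
  g x (a *: u) (b *: v) = a * b * g x u v.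
Proof.
move=> Eu Ev; have E0 := dist0 x; have Ebv := distZ b Ev.
rewrite -[a *: u]addr0 metric_lin // metric0l // addr0.
by rewrite -[b *: v]addr0 metric_linr // (metric_sym g Eu E0) metric0l // addr0 mulrA.
Qed.

Lemma rot0 x : J x 0 = 0.
Proof.
have := rot_lin J (-1) (dist0 x) (dist0 x).
by rewrite scaler0 addr0 scaleN1r addNr.
Qed.

Lemma rotZ x (a : R) u : E x u -> J x (a *: u) = a *: J x u.
Proof.
move=> Eu; have E0 := dist0 x.
by rewrite -[a *: u]addr0 rot_lin // rot0 addr0.
Qed.

Lemma rot_skew x u : E x u -> g x (J x u) u = 0.
Proof.
move=> Eu; have [->|u0] := eqVneq u 0.
  by rewrite rot0 metric0l //; exact: dist0.
have gu := metric_pos g Eu u0.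
pose s := Num.sqrt (g x u u).
have s0 : s != 0 by rewrite sqrtr_eq0 -ltNge.
have Es : E x (s^-1 *: u) by exact: distZ.
have us : g x (s^-1 *: u) (s^-1 *: u) = 1.
  rewrite metricZ // -[X in _ * X](@sqr_sqrtr _ (g x u u)) ?ltW // -/s.
  by rewrite expr2 mulrACA mulVf // mulr1.
have EJ : E x (J x u) by exact: rot_E.
have [_ + _] := rot_unit J Es us.
rewrite rotZ // metricZ // => /eqP; rewrite !mulf_eq0 invr_eq0 (negPf s0) /=.
by move=> /eqP <-; apply: metric_sym => //; exact: rot_E.
Qed.

Fact Psi_linl x w : scalar (fun v => g x (J x (phi x v)) (phi x w)).
Proof.
move=> a u v /=; rewrite eform_lin rot_lin ?metric_lin //;
  by do ?apply: rot_E; exact: eform_E.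
Qed.

Fact Psi_linr x v : scalar (fun w => g x (J x (phi x v)) (phi x w)).
Proof.
by move=> a u w /=; rewrite eform_lin metric_linr //; do ?apply: rot_E;
  exact: eform_E.
Qed.

Fact Psi_alt x v : g x (J x (phi x v)) (phi x v) = 0.
Proof. by rewrite rot_skew //; exact: eform_E. Qed.

Fact Psi_smooth (X Y : vfield M) :
  smooth (fun x => g x (J x (phi x (X x))) (phi x (Y x))).
Proof. exact: (metric_smooth g (rot_app (eform_app X)) (eform_app Y)). Qed.

Definition Psi : form2 := Form2 Psi_linl Psi_linr Psi_alt Psi_smooth.

End Forms.

Record grading := Grading {
  gr3 : subspace_field M; gr2 : subspace_field M; gr1 : subspace_field M }.

Definition is_egrading E (I : grading) : Prop :=
  [/\ gr1 I = E,
      exists k, is_subbundle (gr3 I) k,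
      exists k, is_subbundle (gr2 I) k,
      forall x (v : tangent x), exists! w : tangent x * tangent x * tangent x,
        [/\ gr3 I x w.1.1, gr2 I x w.1.2, gr1 I x w.2 &
            v = w.1.1 + w.1.2 + w.2] &
      forall x (v : tangent x), dist2 E x v <->
        exists a b, [/\ gr2 I x a, gr1 I x b & v = a + b]].

Definition is_theta E (g : metric E) (o : orientation E) (J : rotation g o)
    (I : grading) (theta : form1) : Prop :=
  (forall x (v : tangent x), theta x v = 0 <->
     exists a b, [/\ gr3 I x a, gr1 I x b & v = a + b]) /\
  (forall (X Y : vfield M) (x : M), E x (X x) -> E x (Y x) ->
     d1 theta X Y x = g x (X x) (J x (Y x))).

End SubRiemannian.
Arguments metric_fun {R n M E} g x _ _ : rename.
Arguments oriented_basis {R n M E} o x _ _ : rename.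
Arguments rot_fun {R n M E g o} J x _ : rename.
Arguments eform_fun {R n M E} phi x _ : rename.
Arguments form1_fun {R n M} a x _ : rename.
Arguments form2_fun {R n M} a x _ _ : rename.
Arguments form1 {R n} M.
Arguments form2 {R n} M.
Arguments grading {R n} M.

(* dim M = 5 is part of the type of M. *)
Definition growth_vector_235 (R : realType) (M : manifold R 5)
    (E : subspace_field M) : Prop :=
  [/\ is_subbundle E 2, is_subbundle (dist2 E) 3 &
      forall (x : M) (v : tangent x), dist3 E x v].

(* Main.v *)
From HB Require Import structures.
Require Import Defs.
From mathcomp Require Import all_boot all_order all_algebra.
From mathcomp Require Import all_classical all_reals all_analysis.
From mathcomp Require Import ring.

Set Implicit Arguments.
Unset Strict Implicit.
Unset Printing Implicit Defensive.

Import Order.TTheory GRing.Theory Num.Theory.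
Import numFieldNormedType.Exports.

Local Open Scope classical_set_scope.
Local Open Scope ring_scope.

(** Why the theorem holds.  Let X1 be a unit section of E and put X2 = J X1,
    X3 = [X1, X2], Y1 = [X3, X2], Y2 = [X1, X3].  The normalization of phi,
    applied to X1 and to X2, reads phi Y2 = X2 and phi Y1 = X1, whereas phi kills
    X1, X2, X3, which frame E^-2.  So the five fields form a global frame of TM
    ([adapted_frame_of_unit_section]); let e1, e2, e3, z1, z2 be its dual coframe.
    In these terms E is the common kernel of e3, z1, z2, and E^-2 that of z1, z2,
    and Psi = z1 /\ z2.

    The form theta of a grading vanishes on X1, X2 and on the part of degree -3,
    and d theta (X1, X2) = - theta X3, so the normalization says theta X3 = 1.
    These values determine theta, and conversely define it.

    The existence and uniqueness of the grading is a computation in the coframe.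
    The brackets of the frame give, for two smooth functions c1 and c2,
      d Psi (X1, ., .) = e3 /\ z1 + c2 (z1 /\ z2),
      d Psi (X2, ., .) = e3 /\ z2 - c1 (z1 /\ z2).
    If w1 and w2 are the vectors of degree -3 over Y1 and Y2 modulo E^-2,
    condition (i) says that e3 w1 = c1 and e3 w2 = c2, that is,
    theta = theta0 := e3 - c1 z1 - c2 z2 ([is_theta_theta0]).  Condition (ii) now
    says that the parts of degree -2 and -3 are killed by the contractions
    lam1 and lam2 of d theta0 with X1 and X2.  As lam1 X2 = -1, lam2 X1 = 1 and
    lam1 X1 = lam2 X2 = 0, the forms lam2, - lam1, theta0, z1, z2 are again a
    coframe, and they cut out exactly one grading: degree -3 is the kernel of
    theta0, lam1, lam2, degree -2 that of z1, z2, lam1, lam2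
    ([canonical_is_egrading], [canonical_grading_uniq]).

    Two objects are first defined pointwise and must be shown smooth, the dual
    coframe and theta.  Both are coordinates in a frame, and Cramer's rule over the
    ring of smooth functions writes such coordinates near each point as quotients
    of global smooth functions ([smooth_coordinates], [smooth_quotient]).  The
    tensoriality of the exterior derivative comes from expanding its arguments in
    the global frame, so no cut-off functions occur. *)

(** * Smoothness of inverses, square roots and local quotients *)

Section LocalSmoothness.
Context {R : realType} {V : normedModType R}.
Implicit Types (U : set V) (f : V -> R).

Lemma diff_upto_sub (W : normedModType R) k U U' (f : V -> W) :
  U' `<=` U -> diff_upto k U f -> diff_upto k U' f.
Proof.
move=> sub; elim: k f => [//|k IH] f [df Df].
by split=> [x /sub/df//|v]; exact: IH (Df v).
Qed.

Lemma diff_upto_local (W : normedModType R) k U (f : V -> W) :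
  (forall x, U x -> exists U', [/\ open U', U' x & diff_upto k U' f]) ->
  diff_upto k U f.
Proof.
elim: k f => [//|k IH] f loc; split=> [x /loc [U' [_ U'x [df _]]]|v].
  exact: df.
by apply: IH => x /loc [U' [oU' U'x [_ Df]]]; exists U'; split => //; exact: Df.
Qed.

Lemma diff_upto_inv k U f : open U -> (forall x, U x -> f x != 0) ->
  diff_upto k U f -> diff_upto k U (fun x => (f x)^-1).
Proof.
move=> oU f0; elim: k => [//|k IH] Hf.
have If := IH (diff_uptoW Hf); case: Hf => df Df.
split=> [x Ux|v]; first by apply: differentiableV; [exact: df|exact: f0].
have := diff_upto_mul oU (diff_upto_mul oU (diff_upto_cst k U (-1 : R)) (Df v))
                         (diff_upto_mul oU If If).
apply: diff_upto_congr => // x Ux.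
rewrite deriveV ?f0 //; last by apply: diff_derivable; exact: df.
rewrite -[LHS]/((-1 * 'D_v f x) * ((f x)^-1 * (f x)^-1)).
by rewrite -[RHS]/(- (f x) ^- 2 * 'D_v f x) expr2 invfM; ring.
Qed.

Lemma diff_upto_sqrt k U f : open U -> (forall x, U x -> 0 < f x) ->
  diff_upto k U f -> diff_upto k U (fun x => Num.sqrt (f x)).
Proof.
move=> oU f0; set s := fun x => Num.sqrt (f x).
have s0 x : U x -> s x != 0 by move=> /f0 fx; rewrite gt_eqF // sqrtr_gt0.
elim: k => [//|k IH] Hf.
have Is := IH (diff_uptoW Hf); case: Hf => df Df.
have ds x : U x -> differentiable s x.
  move=> Ux; apply: (@differentiable_comp _ _ _ _ f Num.sqrt); first exact: df.
  apply/derivable1_diffP.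
  by have := is_derive1_sqrt (f0 _ Ux) => -[].
split=> [//|v].
have := diff_upto_mul oU (diff_upto_mul oU (diff_upto_cst k U (2^-1 : R)) (Df v))
                         (diff_upto_inv oU s0 Is).
apply: diff_upto_congr => // x Ux.
have sd : derivable s x v by apply: diff_derivable; exact: ds.
rewrite -[LHS]/((2^-1 * 'D_v f x) * (s x)^-1).
have -> : 'D_v f x = 'D_v (s * s) x.
  apply: near_eq_derive; apply: filterS (open_nbhs_nbhs (conj oU Ux)) => y /f0 fy.
  by rewrite -[RHS]/(s y * s y) -expr2 sqr_sqrtr // ltW.
(* s ^ 2 = f gives 2 s s' = f', which is how the derivative of s is read off *)
have DE : 'D_v (s * s) x = 2 * s x * 'D_v s x.
  by rewrite deriveM // -[LHS]/(s x * 'D_v s x + s x * 'D_v s x); ring.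
by rewrite DE; field; rewrite s0.
Qed.

End LocalSmoothness.

Section SmoothFunctionTheory.
Context {R : realType} {n : nat} {M : manifold R n}.

Lemma Cinf_smooth (f : Cinf M) : smooth f.
Proof. by apply/smooth_predP; exact: valP f. Qed.

Definition Cinf_of (f : M -> R) (sf : smooth f) : Cinf M :=
  MkCinf (introT (smooth_predP f) sf).

Lemma smooth_sqrt (f : M -> R) :
  smooth f -> (forall x, 0 < f x) -> smooth (fun x => Num.sqrt (f x)).
Proof.
move=> sf f0 c Mc k; apply: diff_upto_sqrt; [exact: chart_cod_open| |exact: sf].
by move=> z _; exact: f0.
Qed.

Lemma smooth_inv (f : M -> R) :
  smooth f -> (forall x, f x != 0) -> smooth (fun x => (f x)^-1).
Proof.
move=> sf f0 c Mc k; apply: diff_upto_inv; [exact: chart_cod_open| |exact: sf].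
by move=> z _; exact: f0.
Qed.

Lemma chart_inv_continuous_at (c : @chart R n M) z :
  chart_cod c z -> {for z, continuous (chart_inv c)}.
Proof.
move=> cz; have := @chart_inv_continuous _ _ _ c.
rewrite continuous_open_subspace; last exact: chart_cod_open.
by apply; rewrite inE.
Qed.

Lemma smooth_continuous (f : M -> R) : smooth f -> continuous f.
Proof.
move=> sf x; have [c Mc cx] := atlas_cover x.
have oD := chart_dom_open c.
have cmc : {for x, continuous (chart_map c)}.
  have := @chart_map_continuous _ _ _ c.
  by rewrite continuous_open_subspace //; apply; rewrite inE.
have cz := chart_map_cod cx.
have [df _] := sf c Mc 1%N.
have dc := differentiable_continuous (df _ cz).
have fE : \near x, (f \o chart_inv c) (chart_map c x) = f x.
  by apply: filterS (open_nbhs_nbhs (conj oD cx)) => y cy /=; rewrite chart_mapK.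
have cc : {for x, continuous ((f \o chart_inv c) \o chart_map c)}.
  exact: continuous_comp cmc dc.
rewrite /prop_for /continuous_at /= chart_mapK // in cc.
apply: cvg_trans cc; apply: near_eq_cvg.
by apply: filterS fE => y /=.
Qed.

(** Smoothness is local, and near x the function f is the quotient a / b.  Since
    a and b are themselves global smooth functions, a local formula becomes a
    smooth function without any cut-off. *)
Lemma smooth_quotient (f : M -> R) :
  (forall x, exists a b : Cinf M, b x != 0 /\ \near x, b x * f x = a x) ->
  smooth f.
Proof.
move=> loc c Mc k; apply: diff_upto_local => z cz.
have [a [b [bx near_fab]]] := loc (chart_inv c z).
have ic := chart_inv_continuous_at cz.
have bc : {for chart_inv c z, continuous b}.
  exact: smooth_continuous (Cinf_smooth b) _.
have nb : \forall y \near chart_inv c z, b y != 0 by exact: cvgr_neq0 bc bx.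
have : nbhs z (chart_cod c `&` chart_inv c @^-1`
                 ([set y | b y != 0] `&` [set y | b y * f y = a y])).
  apply: filterI; first exact: open_nbhs_nbhs (conj (@chart_cod_open _ _ _ c) cz).
  by apply: ic; exact: filterI.
rewrite nbhsE => -[U [oU Uz] sU]; exists U; split=> //.
have sub : U `<=` chart_cod c by move=> w /sU[].
have := diff_upto_mul oU
  (diff_upto_sub sub (Cinf_smooth a Mc k))
  (@diff_upto_inv _ _ k _ (b \o chart_inv c) oU _
     (diff_upto_sub sub (Cinf_smooth b Mc k))).
move=> H; apply: diff_upto_congr (H _) => // w /sU[_ [b0 E]] //.
rewrite -[LHS]/(a (chart_inv c w) * (b (chart_inv c w))^-1) -E /=.
by rewrite mulrC mulKf.
Qed.

End SmoothFunctionTheory.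

(** * Independent functionals and exchange of bases *)

Section FiniteDimension.
Context {R : realType}.

Lemma unitmx_inj k (A : 'M[R]_k) :
  (forall u : 'rV[R]_k, u *m A = 0 -> u = 0) -> A \in unitmx.
Proof.
move=> inj; rewrite -row_free_unit -kermx_eq0; apply/rowV0P => u.
by move=> /sub_kermxP; exact: inj.
Qed.

(** Independent functionals are separated by finitely many points.  The point
    added at each stage is one where the combination of the functionals that
    vanishes at all the points already chosen does not vanish. *)
Lemma free_functionals (T : Type) k (v : 'I_k -> T -> R) :
  (forall a : 'rV[R]_k, (forall t, \sum_i a 0 i * v i t = 0) -> a = 0) ->
  exists t : 'I_k -> T, \matrix_(i, j) v i (t j) \in unitmx.
Proof.
elim: k v => [|k IH] v free.
  have t : 'I_0 -> T by move=> i; exfalso; case: i.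
  by exists t; apply: unitmx_inj => u _; apply/rowP => -[].
have combE (u : 'rV[R]_(1 + k)) s : \sum_i u 0 i * v i s =
    lsubmx u 0 0 * v ord0 s + \sum_i rsubmx u 0 i * v (lift ord0 i) s.
  rewrite big_ord_recl; congr (_ * _ + _).
    by rewrite [RHS]mxE; congr (u _ _); exact: val_inj.
  apply: eq_bigr => i _; rewrite [in RHS]mxE; congr (u _ _ * _).
  exact: val_inj.
case: (IH (fun i => v (lift ord0 i))) => [a a0|t tU].
  have : row_mx (0 : 'rV[R]_1) a = 0 :> 'rV[R]_(1 + k).
    by apply: free => s; rewrite combE row_mxKl row_mxKr mxE mul0r add0r.
  by rewrite -row_mx0 => /eq_row_mx[].
set A := (X in X \in unitmx) in tU.
pose w : 'rV[R]_k := \row_j v ord0 (t j).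
(* the unique combination, normalized at v ord0, that vanishes at all the t j *)
pose b : 'rV[R]_(1 + k) := row_mx 1%:M (- (w *m invmx A)).
have [s bs] : exists s, \sum_i b 0 i * v i s != 0.
  apply: contrapT => /forallNP b0.
  have : b = 0 by apply: free => s; apply/eqP/negPn/negP; exact: b0.
  rewrite -row_mx0 => /eq_row_mx[/matrixP/(_ 0 0)].
  by rewrite !mxE /= => /eqP; rewrite oner_eq0.
pose t' (j : 'I_k.+1) := if unlift ord0 j is Some j' then t j' else s.
exists t'; apply: unitmx_inj => u uB.
have colE (j : 'I_k.+1) : \sum_i u 0 i * v i (t' j) = 0.
  move/rowP: uB => /(_ j); rewrite !mxE => uj.
  by rewrite -[RHS]uj; apply: eq_bigr => i _; rewrite mxE.
have ub : (u : 'rV[R]_(1 + k)) = lsubmx (u : 'rV[R]_(1 + k)) 0 0 *: b.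
  rewrite -[u in LHS](@hsubmxK _ 1 1 k u) scale_row_mx; congr row_mx.
    by apply/rowP => i; rewrite (ord1 i) [RHS]mxE [X in _ * X]mxE eqxx mulr1.
  apply: (can_inj (mulmxK tU)).
  rewrite scalerN mulNmx -scalemxAl mulmxKV //; apply/rowP => j.
  have := colE (lift ord0 j); rewrite combE /t' liftK => /eqP.
  rewrite addrC addr_eq0 => /eqP E.
  rewrite [RHS]mxE [X in - X]mxE [X in _ * X]mxE -E [LHS]mxE.
  by apply: eq_bigr => i _; rewrite [A _ _]mxE.
suff u0 : lsubmx (u : 'rV[R]_(1 + k)) 0 0 = 0 by rewrite ub u0 scale0r.
move: ub; set c := lsubmx _ 0 0 => ub.
have := colE ord0; rewrite /t' unlift_none ub.
under eq_bigr do rewrite mxE -mulrA.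
by rewrite -mulr_sumr => /eqP; rewrite mulf_eq0 (negPf bs) orbF => /eqP.
Qed.

Context {V : lmodType R}.

Lemma sub_lspan (A : set V) v : A v -> lspan A v.
Proof. by move=> Av B [_ AB]; exact: AB. Qed.

Lemma sum_mulmx k (u : 'rV[R]_k) (A : 'M[R]_k) (e : 'I_k -> V) :
  \sum_i u 0 i *: (\sum_j A i j *: e j) = \sum_j (u *m A) 0 j *: e j.
Proof.
under eq_bigr do rewrite scaler_sumr.
rewrite exchange_big; apply: eq_bigr => j _.
by rewrite mxE scaler_suml; apply: eq_bigr => i _; rewrite scalerA.
Qed.

Lemma is_basis_coords (D : set V) k (e f : 'I_k -> V) :
  is_basis D e -> (forall i, D (f i)) ->
  exists A : 'M[R]_k, forall i, f i = \sum_j A i j *: e j.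
Proof.
move=> [De _] Df; have /choice[c cP] : forall i, exists a : 'I_k -> R,
    f i = \sum_j a j *: e j by move=> i; apply/De.
exists (\matrix_(i, j) c i j) => i; rewrite cP.
by apply: eq_bigr => j _; rewrite mxE.
Qed.

Lemma sum_row k (a : 'I_k -> R) (e : 'I_k -> V) :
  \sum_i a i *: e i = \sum_i (\row_i a i) 0 i *: e i.
Proof. by apply: eq_bigr => i _; rewrite mxE. Qed.

Lemma is_basis_inj k (D : set V) (e : 'I_k -> V) (u w : 'rV[R]_k) :
  is_basis D e -> \sum_i u 0 i *: e i = \sum_i w 0 i *: e i -> u = w.
Proof.
move=> [_ fe] uw; apply/rowP => i; apply/eqP; rewrite -subr_eq0; apply/eqP.
apply: (fe (fun i => u 0 i - w 0 i)); under eq_bigr do rewrite scalerBl.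
by rewrite sumrB uw subrr.
Qed.

(** The coordinate matrix of a free family in a basis of the same size is
    injective, hence invertible. *)
Lemma free_is_basis (D : set V) k (e f : 'I_k -> V) :
  is_basis D e -> (forall i, D (f i)) ->
  (forall a : 'I_k -> R, \sum_i a i *: f i = 0 -> forall i, a i = 0) ->
  is_basis D f.
Proof.
move=> eB Df free; split=> // v.
have [A fA] := is_basis_coords eB Df.
have AU : A \in unitmx.
  apply: unitmx_inj => u uA; apply/rowP => i; rewrite [RHS]mxE.
  apply: (free (fun i => u 0 i)); under eq_bigr do rewrite fA.
  by rewrite sum_mulmx uA big1 // => j _; rewrite mxE scale0r.
have sumE (u : 'rV[R]_k) : \sum_i u 0 i *: f i = \sum_i (u *m A) 0 i *: e i.
  by under eq_bigr do rewrite fA; rewrite sum_mulmx.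
split=> [/eB.1[a ->]|[a ->]].
  exists (fun i => ((\row_i a i) *m invmx A) 0 i); rewrite sumE mulmxKV //.
  exact: sum_row.
by apply/eB.1; exists (fun i => ((\row_i a i) *m A) 0 i); rewrite -sumE sum_row.
Qed.

Lemma sum_delta k (e : 'I_k -> V) i : \sum_j (i == j)%:R *: e j = e i :> V.
Proof.
rewrite (bigD1 i) //= eqxx scale1r big1 ?addr0 // => j ij.
by rewrite eq_sym (negPf ij) scale0r.
Qed.

Lemma is_basis_mem (D : set V) k (e : 'I_k -> V) i : is_basis D e -> D (e i).
Proof.
by move=> [De _]; apply/De; exists (fun j => (i == j)%:R); rewrite sum_delta.
Qed.

Lemma is_basis_neq0 (D : set V) k (e : 'I_k -> V) i : is_basis D e -> e i != 0.
Proof.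
move=> [_ fe]; apply/negP => /eqP ei0.
have := fe (fun j => (i == j)%:R) _ i; rewrite sum_delta eqxx => /(_ ei0)/eqP.
by rewrite oner_eq0.
Qed.

(** The coordinate matrix A of f in e has a left inverse, made of coordinates of
    e in f; for square matrices that inverse is two-sided, so f is free. *)
Lemma span_is_basis (D : set V) k (e f : 'I_k -> V) :
  is_basis D e -> (forall i, D (f i)) ->
  (forall v, D v -> exists a : 'I_k -> R, v = \sum_i a i *: f i) ->
  is_basis D f.
Proof.
move=> eB Df span.
have [A fA] := is_basis_coords eB Df.
have De i : D (e i) := is_basis_mem i eB.
have /choice[c cP] : forall i, exists a : 'I_k -> R,
    e i = \sum_j a j *: f j by move=> i; exact: span.
pose B := \matrix_(i, j) c i j.
have sumE (u : 'rV[R]_k) : \sum_i u 0 i *: f i = \sum_i (u *m A) 0 i *: e i.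
  by under eq_bigr do rewrite fA; rewrite sum_mulmx.
have BA : B *m A = 1%:M.
  apply/row_matrixP => i; rewrite row_mul; apply: (is_basis_inj eB).
  rewrite -sumE.
  transitivity (e i).
    by rewrite [RHS]cP; apply: eq_bigr => j _; rewrite !mxE.
  by rewrite -sum_delta; apply: eq_bigr => j _; rewrite !mxE.
have AB := mulmx1C BA.
split=> [v|a a0 i].
  split=> [/span//|[a ->]]; rewrite sum_row sumE; apply/eB.1; exact: ex_intro.
suff : \row_i a i = 0 by move/rowP/(_ i); rewrite !mxE.
rewrite -[LHS]mulmx1 -AB mulmxA (_ : _ *m A = 0) ?mul0mx //.
apply: (is_basis_inj eB); rewrite -sumE -sum_row a0 big1 // => j _.
by rewrite mxE scale0r.
Qed.

End FiniteDimension.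

(** * Vector fields and forms over the ring of smooth functions *)

Section VectorFields.
Context {R : realType} {n : nat} {M : manifold R n}.
Implicit Types (f : Cinf M) (X Y Z W : vfield M).

Lemma tangent_ext x (u v : tangent x) : (forall f, u f = v f) -> u = v.
Proof. by move=> uv; apply/val_inj/funext. Qed.

Lemma tangent_linE x (a : R) (u v : tangent x) f :
  (a *: u + v) f = a * u f + v f.
Proof. by []. Qed.

Lemma tangentZ x (v : tangent x) (a : R) f : v (a *: f) = a * v f.
Proof.
have := tangent_lin v a f 0; rewrite addr0 => ->.
have := tangent_lin v (-1) 0 0; rewrite scaler0 addr0 mulN1r addNr => ->.
by rewrite addr0.
Qed.

Lemma vfield_ext X Y : (forall x, X x = Y x) -> X = Y.
Proof.
case: X Y => [X pX] [Y pY] /= XY.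
have {}XY : X = Y by apply/functional_extensionality_dep.
by case: _ / XY pY => pY; congr VField; exact: Prop_irrelevance.
Qed.

Fact vfield_comb_smooth f X Y : smooth_field (fun x => f x *: X x + Y x).
Proof.
by move=> h; exact: (Cinf_smooth (f * vfield_act X h + vfield_act Y h)).
Qed.

Definition vfield_comb f X Y : vfield M := VField (vfield_comb_smooth f X Y).

Fact vfield_zero_smooth : smooth_field (fun x : M => 0 : tangent x).
Proof. by move=> h; exact: smooth_cst 0. Qed.

Definition vfield_zero : vfield M := VField vfield_zero_smooth.

Definition cst_Cinf (a : R) : Cinf M := Cinf_of (smooth_cst a).

Lemma bracketC X Y x : bracket X Y x = - bracket Y X x.
Proof.
apply: tangent_ext => f; rewrite -[RHS]/(- bracket Y X x f).
by rewrite -[LHS]/(bracket_fun X Y x f) -[X in _ = - X]/(bracket_fun Y X x f) opprB.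
Qed.

Lemma bracket_combE f X X' Y :
  bracket (vfield_comb f X X') Y =
  vfield_comb f (bracket X Y) (vfield_comb (- vfield_act Y f) X (bracket X' Y)).
Proof.
apply: vfield_ext => x; apply: tangent_ext => h.
rewrite -[LHS]/(f x * X x (vfield_act Y h) + X' x (vfield_act Y h) -
               Y x (vfield_act (vfield_comb f X X') h)).
rewrite -[RHS]/(f x * bracket_fun X Y x h +
                (- (Y x f) * X x h + bracket_fun X' Y x h)) /bracket_fun.
have -> : vfield_act (vfield_comb f X X') h = f * vfield_act X h + vfield_act X' h.
  exact/val_inj.
by rewrite tangentD tangent_leibniz /=; ring.
Qed.

Lemma form1_app_comb (a : form1 M) f X X' :
  form1_app a (vfield_comb f X X') = f * form1_app a X + form1_app a X'.
Proof. by apply/val_inj/funext => x; exact: form1_lin. Qed.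

Lemma form1D (a : form1 M) x (u v : tangent x) : a x (u + v) = a x u + a x v.
Proof. by have := form1_lin a 1 u v; rewrite scale1r mul1r. Qed.

Lemma form1_0 (a : form1 M) x : a x 0 = 0.
Proof. by apply: (addrI (a x 0)); rewrite -form1D !addr0. Qed.

Lemma form1Z (a : form1 M) x (k : R) (u : tangent x) : a x (k *: u) = k * a x u.
Proof. by rewrite -[_ *: _]addr0 form1_lin form1_0 addr0. Qed.

Lemma form1N (a : form1 M) x (u : tangent x) : a x (- u) = - a x u.
Proof. by rewrite -scaleN1r form1Z mulN1r. Qed.

Lemma form1_ext (a b : form1 M) : (forall x v, a x v = b x v) -> a = b.
Proof.
case: a b => [a la sa] [b lb sb] /= ab.
have {}ab : a = b by apply/functional_extensionality_dep => x; apply/funext.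
case: _ / ab lb sb => lb sb.
by congr Form1; exact: Prop_irrelevance.
Qed.

Lemma form2_altC (w : form2 M) x (u v : tangent x) : w x u v = - w x v u.
Proof.
have := form2_alt w (1 *: u + v).
rewrite (form2_linl w) !(form2_linr w _ 1 u v) !form2_alt !mul1r add0r addr0.
by move/eqP; rewrite addr_eq0 => /eqP.
Qed.

(** The exterior derivative is linear over the smooth functions: the terms in
    which f is differentiated cancel. *)
Lemma d1_comb (a : form1 M) f X X' Y x :
  d1 a (vfield_comb f X X') Y x = f x * d1 a X Y x + d1 a X' Y x.
Proof.
rewrite /d1 bracket_combE !form1_app_comb.
have E P Q S : (P - Q - S : Cinf M) x = P x - Q x - S x by [].
rewrite !E.
rewrite -[vfield_act _ _ x]/(f x * X x (form1_app a Y) + X' x (form1_app a Y)).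
rewrite -[vfield_act _ _ x]/(Y x (f * form1_app a X + form1_app a X')).
rewrite tangentD tangent_leibniz.
rewrite -[X in _ - X]/(f x * a x (bracket X Y x) +
    (- (Y x f) * a x (X x) + a x (bracket X' Y x))).
rewrite -[vfield_act X _ x]/(X x (form1_app a Y)).
rewrite -[vfield_act X' _ x]/(X' x (form1_app a Y)).
rewrite -[vfield_act Y (form1_app a X) x]/(Y x (form1_app a X)).
rewrite -[vfield_act Y (form1_app a X') x]/(Y x (form1_app a X')).
rewrite -[form1_app a X x]/(a x (X x)).
rewrite -[form1_app a (bracket X Y) x]/(a x (bracket X Y x)).
rewrite -[form1_app a (bracket X' Y) x]/(a x (bracket X' Y x)).
ring.
Qed.

Lemma d1C (a : form1 M) X Y x : d1 a X Y x = - d1 a Y X x.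
Proof.
rewrite -[LHS]/(X x (form1_app a Y) - Y x (form1_app a X) - a x (bracket X Y x)).
rewrite -[d1 a Y X x]/(Y x (form1_app a X) - X x (form1_app a Y) -
                       a x (bracket Y X x)).
by rewrite bracketC form1N; ring.
Qed.

Lemma d2E (w : form2 M) X Y Z x : d2 w X Y Z x =
  X x (form2_app w Y Z) - Y x (form2_app w X Z) + Z x (form2_app w X Y)
  - w x (bracket X Y x) (Z x) + w x (bracket X Z x) (Y x)
  - w x (bracket Y Z x) (X x).
Proof. by []. Qed.

Lemma form2_app_comb (w : form2 M) f X X' Y :
  form2_app w (vfield_comb f X X') Y = f * form2_app w X Y + form2_app w X' Y.
Proof. by apply/val_inj/funext => x; exact: form2_linl. Qed.

Lemma form2_appC (w : form2 M) X Y : form2_app w X Y = - form2_app w Y X.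
Proof. by apply/val_inj/funext => x; exact: form2_altC. Qed.

Lemma form2Nl (w : form2 M) x (u v : tangent x) : w x (- u) v = - w x u v.
Proof.
have w0 : w x 0 v = 0.
  by have := form2_linl w v (-1) 0 0; rewrite scaler0 addr0 mulN1r addNr.
by have := form2_linl w v (-1) u 0; rewrite scaleN1r addr0 mulN1r w0 addr0.
Qed.

Lemma tangentN x (v : tangent x) f : v (- f) = - v f.
Proof. by rewrite -scaleN1r tangentZ mulN1r. Qed.

Lemma d2C12 (w : form2 M) X Y Z x : d2 w X Y Z x = - d2 w Y X Z x.
Proof.
rewrite !d2E (bracketC Y X) form2Nl (form2_appC w X Y) tangentN; ring.
Qed.

Lemma d2C23 (w : form2 M) X Y Z x : d2 w X Y Z x = - d2 w X Z Y x.
Proof.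
rewrite !d2E (bracketC Z Y) form2Nl (form2_appC w Y Z) tangentN; ring.
Qed.

Lemma d2_comb (w : form2 M) f X X' Y Z x :
  d2 w (vfield_comb f X X') Y Z x = f x * d2 w X Y Z x + d2 w X' Y Z x.
Proof.
rewrite !d2E !bracket_combE !form2_app_comb !tangentD !tangent_leibniz.
rewrite -[vfield_comb f X X' x]/(f x *: X x + X' x).
rewrite -[vfield_comb f (bracket X Y) _ x]/(f x *: bracket X Y x +
  (- (Y x f) *: X x + bracket X' Y x)).
rewrite -[vfield_comb f (bracket X Z) _ x]/(f x *: bracket X Z x +
  (- (Z x f) *: X x + bracket X' Z x)).
rewrite !(form2_linl w) !(form2_linr w) tangent_linE.
rewrite -[form2_app w X Z x]/(w x (X x) (Z x)).
rewrite -[form2_app w X Y x]/(w x (X x) (Y x)).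
ring.
Qed.

Lemma tangent0 x (v : @tangent R n M x) : v 0 = 0.
Proof. by have := tangentZ v 0 0; rewrite scale0r mul0r. Qed.

Fact form1_comb_lin (f : Cinf M) (a b : form1 M) x :
  scalar (fun v : tangent x => f x * a x v + b x v).
Proof. by move=> k u v /=; rewrite !form1_lin; ring. Qed.

Fact form1_comb_smooth (f : Cinf M) (a b : form1 M) (X : vfield M) :
  smooth (fun x => f x * a x (X x) + b x (X x)).
Proof. exact: (Cinf_smooth (f * form1_app a X + form1_app b X)). Qed.

Definition form1_comb (f : Cinf M) (a b : form1 M) : form1 M :=
  Form1 (form1_comb_lin f a b) (form1_comb_smooth f a b).

Fact form1_zero_lin (x : M) : scalar (fun _ : tangent x => 0 : R).
Proof. by move=> k u v /=; rewrite mulr0 addr0. Qed.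

Fact form1_zero_smooth (X : vfield M) : smooth (fun x : M => 0 : R).
Proof. exact: smooth_cst. Qed.

Definition form1_zero : form1 M := Form1 form1_zero_lin form1_zero_smooth.

Lemma form1_app0 (a : form1 M) (X : vfield M) :
  (forall x, a x (X x) = 0) -> form1_app a X = 0.
Proof. by move=> aX; apply/val_inj/funext. Qed.

Lemma form2_app0 (w : form2 M) (X Y : vfield M) :
  (forall x, w x (X x) (Y x) = 0) -> form2_app w X Y = 0.
Proof. by move=> wXY; apply/val_inj/funext. Qed.

Lemma bracket_self (X : vfield M) x : bracket X X x = 0.
Proof.
by apply: tangent_ext => f; rewrite -[LHS]/(bracket_fun X X x f) /bracket_fun subrr.
Qed.

Lemma d1_self (a : form1 M) X x : d1 a X X x = 0.
Proof.
have /eqP := d1C a X X x; rewrite -addr_eq0 -mulr2n mulrn_eq0 /=.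
by move/eqP.
Qed.

Lemma d2_self (w : form2 M) X Y x : d2 w X Y Y x = 0.
Proof.
have /eqP := d2C23 w X Y Y x; rewrite -addr_eq0 -mulr2n mulrn_eq0 /=.
by move/eqP.
Qed.

Lemma bracket_opp (X Y V : vfield M) x :
  (forall y, V y = - X y) -> bracket Y V x = bracket X Y x.
Proof.
move=> VX; apply: tangent_ext => f.
rewrite -[LHS]/(Y x (vfield_act V f) - V x (vfield_act Y f)).
rewrite -[RHS]/(X x (vfield_act Y f) - Y x (vfield_act X f)) VX.
have -> : vfield_act V f = - vfield_act X f.
  by apply/val_inj/funext => y; rewrite /= VX.
by rewrite tangentN -[(- X x) _]/(- X x (vfield_act Y f)); ring.
Qed.

Lemma bracket_comb f (X X' Y : vfield M) x : bracket (vfield_comb f X X') Y x =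
  f x *: bracket X Y x + (- Y x f *: X x + bracket X' Y x).
Proof. by rewrite bracket_combE. Qed.

Lemma bracket0 (Y : vfield M) x : bracket vfield_zero Y x = 0.
Proof.
apply: tangent_ext => f.
rewrite -[LHS]/(0 - Y x (vfield_act vfield_zero f)).
have -> : vfield_act vfield_zero f = 0 by apply/val_inj/funext.
by rewrite tangent0 subr0.
Qed.

Lemma d1E (a : form1 M) (X Y : vfield M) x : d1 a X Y x =
  X x (form1_app a Y) - Y x (form1_app a X) - a x (bracket X Y x).
Proof. by []. Qed.

End VectorFields.

Section SubspaceFields.
Context {R : realType} {n : nat} {M : manifold R n}.

Lemma subspace_field_ext (D D' : subspace_field M) :
  (forall x v, D x v <-> D' x v) -> D = D'.
Proof.
case: D D' => [D pD] [D' pD'] /= DD.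
have {}DD : D = D'.
  apply/functional_extensionality_dep => x; apply/funext => v.
  exact/propext.
by case: _ / DD pD' => pD'; congr SubspaceField; exact: Prop_irrelevance.
Qed.

Fact ker_form_subspace (a : form1 M) x : is_subspace [set v : tangent x | a x v = 0].
Proof.
split=> [|k u v /= u0 v0]; first exact: form1_0.
by rewrite form1_lin u0 v0 mulr0 addr0.
Qed.

Definition ker_form (a : form1 M) : subspace_field M :=
  SubspaceField _ (ker_form_subspace a).

Fact cap_field_subspace (D D' : subspace_field M) x : is_subspace (D x `&` D' x).
Proof.
have [[D0 DD] [D'0 DD']] := (dist_subspace D x, dist_subspace D' x).
by split=> [//|k u v [Du D'u] [Dv D'v]]; split; [exact: DD|exact: DD'].
Qed.

Definition cap_field (D D' : subspace_field M) : subspace_field M :=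
  SubspaceField _ (cap_field_subspace D D').

Lemma subspaceD (D : subspace_field M) x (u v : tangent x) :
  D x u -> D x v -> D x (u + v).
Proof. by move=> Du Dv; rewrite -[u]scale1r; exact: (dist_subspace D x).2. Qed.

Lemma subspace0 (D : subspace_field M) x : D x 0.
Proof. by have [] := dist_subspace D x. Qed.

Lemma subspaceZ (D : subspace_field M) x (a : R) (u : tangent x) :
  D x u -> D x (a *: u).
Proof.
move=> Du; rewrite -[_ *: _]addr0; apply: (dist_subspace D x).2 => //.
exact: subspace0.
Qed.

Lemma subspaceB (D : subspace_field M) x (u v : tangent x) :
  D x u -> D x v -> D x (u - v).
Proof. by move=> Du Dv; rewrite -scaleN1r addrC; exact: (dist_subspace D x).2. Qed.

End SubspaceFields.

(** * Smooth coordinates with respect to a frame *)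

Section Coordinates.
Context {R : realType} {n : nat} {M : manifold R n}.

(** Evaluation at a point, as a ring morphism: it carries determinants and
    adjugates over the smooth functions to real ones. *)
Definition Cinf_eval (x : M) (f : Cinf M) : R := f x.

Fact Cinf_eval_zmod_morphism x : zmod_morphism (Cinf_eval x).
Proof. by []. Qed.
HB.instance Definition _ x := GRing.isZmodMorphism.Build (Cinf M) R
  (Cinf_eval x) (Cinf_eval_zmod_morphism x).

Fact Cinf_eval_monoid_morphism x : monoid_morphism (Cinf_eval x).
Proof. by []. Qed.
HB.instance Definition _ x := GRing.isMonoidMorphism.Build (Cinf M) R
  (Cinf_eval x) (Cinf_eval_monoid_morphism x).

Definition free_at k (F : 'I_k -> vfield M) (x : M) : Prop :=
  forall a : 'I_k -> R, \sum_i a i *: F i x = 0 -> forall i, a i = 0.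

Lemma tangent_sum (x : M) k (a : 'I_k -> R) (v : 'I_k -> tangent x) f :
  (\sum_i a i *: v i) f = \sum_i a i * v i f.
Proof. by elim/big_rec2: _ => [//|i r s _ <-]. Qed.

(** Cramer's rule over the ring of smooth functions.  Independence of the
    fields at x provides functions f_j for which the matrix (F_i f_j) is
    invertible at x; the coordinates solve the linear system obtained by
    differentiating the f_j. *)
Lemma smooth_coordinates k (F : 'I_k -> vfield M) (V : vfield M)
    (c : 'I_k -> M -> R) x :
  free_at F x -> (\forall y \near x, V y = \sum_i c i y *: F i y) ->
  forall i, exists a b : Cinf M, b x != 0 /\ \forall y \near x, b y * c i y = a y.
Proof.
move=> free Vc i.
have [f fU] : exists f : 'I_k -> Cinf M, \matrix_(i, j) F i x (f j) \in unitmx.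
  apply: (@free_functionals R (Cinf M) k (fun i => F i x)) => a a0.
  apply/rowP => j; rewrite [RHS]mxE; apply: (free (fun i => a 0 i)).
  by apply: tangent_ext => h; rewrite tangent_sum a0.
pose A := \matrix_(i, j) vfield_act (F i) (f j).
have AE y : map_mx (Cinf_eval y) A = \matrix_(i, j) F i y (f j).
  by apply/matrixP => p q; rewrite !mxE.
exists (((\row_j vfield_act V (f j)) *m \adj A) 0 i), (\det A); split.
  rewrite -[X in X != 0]/(Cinf_eval x (\det A)) -det_map_mx AE -unitfE.
  by rewrite -unitmxE.
apply: filterS Vc => y Vy.
rewrite -[LHS]/(Cinf_eval y (\det A) * c i y) -[RHS]/(Cinf_eval y _).
rewrite -det_map_mx.
transitivity ((map_mx (Cinf_eval y) ((\row_j vfield_act V (f j)) *m \adj A)) 0 i);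
  last by rewrite mxE.
rewrite map_mxM map_mx_adj.
have -> : map_mx (Cinf_eval y) (\row_j vfield_act V (f j)) =
    (\row_j c j y) *m map_mx (Cinf_eval y) A.
  apply/rowP => j; rewrite AE !mxE -[LHS]/(V y (f j)) Vy tangent_sum.
  by apply: eq_bigr => l _; rewrite !mxE.
by rewrite -mulmxA mul_mx_adj mul_mx_scalar !mxE.
Qed.

Lemma smooth_frame_coordinates k (F : 'I_k -> vfield M) (V : vfield M)
    (c : 'I_k -> M -> R) :
  (forall x, free_at F x) -> (forall y, V y = \sum_i c i y *: F i y) ->
  forall i, smooth (c i).
Proof.
move=> free Vc i; apply: smooth_quotient => x.
apply: (smooth_coordinates (free x) (V := V)).
by apply: nearW.
Qed.

(** Only the smoothness of the dual coframe is at stake: its values on a field are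
    the coordinates of that field. *)
Lemma coframe_exists k (F : 'I_k -> vfield M) :
  (forall x, is_basis [set: tangent x] (fun i => F i x)) ->
  exists e : 'I_k -> form1 M,
    (forall x v, v = \sum_i e i x v *: F i x) /\
    (forall x i j, e i x (F j x) = (i == j)%:R).
Proof.
move=> FB.
have free x : free_at F x by have [] := FB x.
have /choice[c cP] : forall p : {x : M & tangent x}, exists a : 'I_k -> R,
    projT2 p = \sum_i a i *: F i (projT1 p).
  by move=> [x v]; have [spanF _] := FB x; apply/spanF.
pose e i x (v : tangent x) := c (existT _ x v) i.
have eP x v : v = \sum_i e i x v *: F i x by exact: (cP (existT _ x v)).
have uniq x (v : tangent x) (a : 'I_k -> R) :
    v = \sum_i a i *: F i x -> forall i, e i x v = a i.
  move=> va i; apply/eqP; rewrite -subr_eq0; apply/eqP.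
  apply: (free x (fun i => e i x v - a i)).
  by under eq_bigr do rewrite scalerBl; rewrite sumrB -eP -va subrr.
have elin i x : scalar (e i x).
  move=> a u v; apply: (uniq _ _ (fun i => a * e i x u + e i x v)).
  under eq_bigr do rewrite scalerDl -scalerA.
  by rewrite big_split /= -scaler_sumr -!eP.
have esm i (X : vfield M) : smooth (fun x => e i x (X x)).
  apply: (smooth_frame_coordinates (V := X) (c := fun i x => e i x (X x)) free).
  by move=> y; exact: eP.
exists (fun i => Form1 (elin i) (esm i)); split=> [x v|x i j]; first exact: eP.
apply: (uniq _ _ (fun i => (i == j)%:R)).
rewrite (bigD1 j) //= eqxx scale1r big1 ?addr0 // => l lj.
by rewrite (negPf lj) scale0r.
Qed.

End Coordinates.

(** * Exterior derivatives in an adapted frame *)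

Section AdaptedFrameDef.
Context {R : realType} {n : nat} {M : manifold R n}.

(** All that the computations use of E, g, J and phi.  The fields are a frame of TM
    with dual coframe e1, e2, e3, z1, z2, where X1 and X2 span E, X3 completes them
    to a frame of E^-2, and Y1, Y2 represent TM / E^-2. *)
Record adapted_frame (E : subspace_field M) (g : metric E) (o : orientation E)
    (J : rotation g o) (phi : eform E) := AdaptedFrame {
  frX1 : vfield M; frX2 : vfield M; frX3 : vfield M;
  frY1 : vfield M; frY2 : vfield M;
  fre1 : form1 M; fre2 : form1 M; fre3 : form1 M;
  frz1 : form1 M; frz2 : form1 M;
  fr_expand : forall x (v : tangent x),
    v = fre1 x v *: frX1 x + (fre2 x v *: frX2 x + (fre3 x v *: frX3 x +
        (frz1 x v *: frY1 x + frz2 x v *: frY2 x)));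
  fr_X1 : forall x, [/\ fre1 x (frX1 x) = 1, fre2 x (frX1 x) = 0,
    fre3 x (frX1 x) = 0, frz1 x (frX1 x) = 0 & frz2 x (frX1 x) = 0];
  fr_X2 : forall x, [/\ fre1 x (frX2 x) = 0, fre2 x (frX2 x) = 1,
    fre3 x (frX2 x) = 0, frz1 x (frX2 x) = 0 & frz2 x (frX2 x) = 0];
  fr_X3 : forall x, [/\ fre1 x (frX3 x) = 0, fre2 x (frX3 x) = 0,
    fre3 x (frX3 x) = 1, frz1 x (frX3 x) = 0 & frz2 x (frX3 x) = 0];
  fr_Y1 : forall x, [/\ fre1 x (frY1 x) = 0, fre2 x (frY1 x) = 0,
    fre3 x (frY1 x) = 0, frz1 x (frY1 x) = 1 & frz2 x (frY1 x) = 0];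
  fr_Y2 : forall x, [/\ fre1 x (frY2 x) = 0, fre2 x (frY2 x) = 0,
    fre3 x (frY2 x) = 0, frz1 x (frY2 x) = 0 & frz2 x (frY2 x) = 1];
  fr_E : forall x (v : tangent x),
    E x v <-> [/\ fre3 x v = 0, frz1 x v = 0 & frz2 x v = 0];
  fr_dist2 : forall x (v : tangent x),
    dist2 E x v <-> frz1 x v = 0 /\ frz2 x v = 0;
  fr_br12 : forall x, bracket frX1 frX2 x = frX3 x;
  fr_br13 : forall x, bracket frX1 frX3 x = frY2 x;
  fr_br23 : forall x, bracket frX2 frX3 x = - frY1 x;
  fr_gJ : forall x (u v : tangent x), E x u -> E x v ->
    g x u (J x v) = fre2 x u * fre1 x v - fre1 x u * fre2 x v;
  fr_Psi : forall x (u v : tangent x),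
    Psi J phi x u v = frz1 x u * frz2 x v - frz2 x u * frz1 x v }.

End AdaptedFrameDef.

Section AdaptedFrame.
Context {R : realType} {n : nat} {M : manifold R n} {E : subspace_field M}
  {g : metric E} {o : orientation E} {J : rotation g o} {phi : eform E}
  (fr : adapted_frame J phi).

Local Notation X1 := (frX1 fr).
Local Notation X2 := (frX2 fr).
Local Notation X3 := (frX3 fr).
Local Notation Y1 := (frY1 fr).
Local Notation Y2 := (frY2 fr).
Local Notation e1 := (fre1 fr).
Local Notation e2 := (fre2 fr).
Local Notation e3 := (fre3 fr).
Local Notation z1 := (frz1 fr).
Local Notation z2 := (frz2 fr).

Implicit Types (U V W A B : vfield M) (x : M).

(** A functional linear over the smooth functions depends pointwise on its
    argument: expand the argument in the global frame. *)
Lemma frame_tensor (A : vfield M -> M -> R) :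
  (forall f X Y x, A (vfield_comb f X Y) x = f x * A X x + A Y x) ->
  forall V x, A V x = e1 x (V x) * A X1 x + (e2 x (V x) * A X2 x +
    (e3 x (V x) * A X3 x + (z1 x (V x) * A Y1 x + z2 x (V x) * A Y2 x))).
Proof.
move=> Alin V x.
have A0 : A (vfield_zero) x = 0.
  have E0 : vfield_zero =
      vfield_comb (cst_Cinf (-1)) vfield_zero vfield_zero :> vfield M.
    by apply: vfield_ext => y; rewrite -[RHS]/(- 1 *: 0 + 0) scaler0 addr0.
  by rewrite E0 Alin mulN1r addNr.
have VE : V = vfield_comb (form1_app e1 V) X1 (vfield_comb (form1_app e2 V) X2
    (vfield_comb (form1_app e3 V) X3 (vfield_comb (form1_app z1 V) Y1
      (vfield_comb (form1_app z2 V) Y2 vfield_zero)))).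
  apply: vfield_ext => y; rewrite {1}[V y](fr_expand fr).
  by rewrite -[z2 y (V y) *: Y2 y]addr0.
by rewrite {1}VE !Alin A0 addr0.
Qed.

Lemma d1_expand (a : form1 M) U V x : d1 a U V x =
  e1 x (V x) * d1 a U X1 x + (e2 x (V x) * d1 a U X2 x +
  (e3 x (V x) * d1 a U X3 x +
  (z1 x (V x) * d1 a U Y1 x + z2 x (V x) * d1 a U Y2 x))).
Proof.
apply: (frame_tensor (A := fun V => d1 a U V)) => f X Y y.
by rewrite d1C d1_comb (d1C a X) (d1C a Y); ring.
Qed.

Lemma d2_expand (w : form2 M) U V W x : d2 w U V W x =
  e1 x (V x) * d2 w U X1 W x + (e2 x (V x) * d2 w U X2 W x +
  (e3 x (V x) * d2 w U X3 W x +
  (z1 x (V x) * d2 w U Y1 W x + z2 x (V x) * d2 w U Y2 W x))).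
Proof.
apply: (frame_tensor (A := fun V => d2 w U V W)) => f X Y y.
by rewrite d2C12 d2_comb (d2C12 w X) (d2C12 w Y); ring.
Qed.

(** The rule by which every condition on U in E is tested on X1 and X2 only. *)
Lemma d1_expandE (a : form1 M) U V x : E x (U x) ->
  d1 a U V x = e1 x (U x) * d1 a X1 V x + e2 x (U x) * d1 a X2 V x.
Proof.
move=> /(fr_E fr)[u3 u4 u5].
by rewrite d1C d1_expand u3 u4 u5 (d1C a X1) (d1C a X2); ring.
Qed.

Lemma d2_expandE (w : form2 M) U V W x : E x (U x) ->
  d2 w U V W x = e1 x (U x) * d2 w X1 V W x + e2 x (U x) * d2 w X2 V W x.
Proof.
move=> /(fr_E fr)[u3 u4 u5].
by rewrite d2C12 d2_expand u3 u4 u5 (d2C12 w X1) (d2C12 w X2); ring.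
Qed.

Lemma form1_expand (a : form1 M) x v : a x v =
  e1 x v * a x (X1 x) + (e2 x v * a x (X2 x) + (e3 x v * a x (X3 x) +
  (z1 x v * a x (Y1 x) + z2 x v * a x (Y2 x)))).
Proof. by rewrite {1}[v](fr_expand fr) !form1_lin form1Z. Qed.

Lemma E_X1 x : E x (X1 x).
Proof. by apply/(fr_E fr); have [] := fr_X1 fr x. Qed.

Lemma E_X2 x : E x (X2 x).
Proof. by apply/(fr_E fr); have [] := fr_X2 fr x. Qed.

Lemma E_dist2 x v : E x v -> dist2 E x v.
Proof. by move=> /(fr_E fr)[_ ? ?]; apply/(fr_dist2 fr). Qed.

Lemma E_expand x v : E x v -> v = e1 x v *: X1 x + e2 x v *: X2 x.
Proof.
move=> /(fr_E fr)[v3 v4 v5].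
by rewrite {1}[v](fr_expand fr) v3 v4 v5 !scale0r !addr0.
Qed.

(** Constant coefficients in the frame extend a vector to a field, so that
    conditions on fields can be tested on vectors. *)
Lemma field_through x (v : tangent x) : exists V : vfield M, V x = v.
Proof.
exists (vfield_comb (cst_Cinf (e1 x v)) X1 (vfield_comb (cst_Cinf (e2 x v)) X2
    (vfield_comb (cst_Cinf (e3 x v)) X3 (vfield_comb (cst_Cinf (z1 x v)) Y1
      (vfield_comb (cst_Cinf (z2 x v)) Y2 vfield_zero))))).
rewrite [RHS](fr_expand fr).
by rewrite -[z2 x v *: Y2 x]addr0.
Qed.

Definition contract_d1 (a : form1 M) (U : vfield M) : form1 M :=
  form1_comb (d1 a U X1) e1 (form1_comb (d1 a U X2) e2 (form1_comb (d1 a U X3) e3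
    (form1_comb (d1 a U Y1) z1 (form1_comb (d1 a U Y2) z2 form1_zero)))).

Lemma contract_d1E a U V x : contract_d1 a U x (V x) = d1 a U V x.
Proof.
rewrite [RHS]d1_expand /contract_d1 /= addr0; ring.
Qed.

Section Theta.
Variable theta : form1 M.
Hypotheses (t1 : forall x, theta x (X1 x) = 0) (t2 : forall x, theta x (X2 x) = 0).

(** Cartan's formula: the two derivative terms act on zero functions. *)
Lemma d1_X12 x : d1 theta X1 X2 x = - theta x (X3 x).
Proof.
by rewrite d1E !form1_app0 // !tangent0 (fr_br12 fr) !sub0r oppr0 add0r.
Qed.

(** E has rank two, so d theta is determined on E by its value at X1, X2. *)
Lemma d1_E U V x : E x (U x) -> E x (V x) -> d1 theta U V x =
  theta x (X3 x) * (e2 x (U x) * e1 x (V x) - e1 x (U x) * e2 x (V x)).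
Proof.
move=> EU EV; rewrite (d1_expandE _ _ EU) (d1C _ X1 V) (d1C _ X2 V).
by rewrite !(d1_expandE _ _ EV) !d1_self (d1C _ X2 X1) d1_X12; ring.
Qed.

End Theta.

(* psi stands for Psi, which enters only through its formula in the coframe *)
Context (psi : form2 M)
  (psiE : forall x u v, psi x u v = z1 x u * z2 x v - z2 x u * z1 x v).

(** E^-2 is the kernel of psi, so among the six terms of d psi (A, B, W) only the
    one containing the bracket of A and B survives. *)
Lemma psi_d2_dist2 A B W x :
  (forall y, dist2 E y (A y)) -> (forall y, dist2 E y (B y)) ->
  d2 psi A B W x =
  z2 x (bracket A B x) * z1 x (W x) - z1 x (bracket A B x) * z2 x (W x).
Proof.
move=> DA DB.
have P0 C V y : (forall y, dist2 E y (C y)) -> psi y (C y) (V y) = 0.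
  move=> DC; have [c1 c2] := (fr_dist2 fr _).1 (DC y).
  by rewrite psiE c1 c2 !mul0r subrr.
have Q0 C y v : (forall y, dist2 E y (C y)) -> psi y v (C y) = 0.
  move=> DC; have [c1 c2] := (fr_dist2 fr _).1 (DC y).
  by rewrite psiE c1 c2 !mulr0 subrr.
rewrite d2E !form2_app0 ?tangent0; do ?by move=> y; exact: P0.
by rewrite (Q0 B) // (Q0 A) // psiE; ring.
Qed.

(** The components along X3 that condition (i) forces on the vectors of degree -3
    over Y1 and Y2; see [is_theta_theta0]. *)
Definition coefY1 : Cinf M := - d2 psi X2 Y1 Y2.
Definition coefY2 : Cinf M := d2 psi X1 Y1 Y2.

Lemma dist2_X1 x : dist2 E x (X1 x). Proof. exact: E_dist2 (E_X1 x). Qed.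
Lemma dist2_X2 x : dist2 E x (X2 x). Proof. exact: E_dist2 (E_X2 x). Qed.
Lemma dist2_X3 x : dist2 E x (X3 x).
Proof. by apply/(fr_dist2 fr); have [] := fr_X3 fr x. Qed.

(** d psi (X1, ., .) = e3 /\ z1 + c2 (z1 /\ z2): the first term comes from
    [X1, X3] = Y2, the second is the definition of c2 = [coefY2]. *)
Lemma psi_d2_X1 V W x : d2 psi X1 V W x =
  e3 x (V x) * z1 x (W x) - z1 x (V x) * e3 x (W x) +
  coefY2 x * (z1 x (V x) * z2 x (W x) - z2 x (V x) * z1 x (W x)).
Proof.
have left_slot V' W' : d2 psi X1 V' W' x = e3 x (V' x) * z1 x (W' x) +
    (z1 x (V' x) * d2 psi X1 Y1 W' x + z2 x (V' x) * d2 psi X1 Y2 W' x).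
  rewrite d2_expand (psi_d2_dist2 _ _ dist2_X1 dist2_X1).
  rewrite (psi_d2_dist2 _ _ dist2_X1 dist2_X2) (psi_d2_dist2 _ _ dist2_X1 dist2_X3).
  rewrite bracket_self (fr_br12 fr) (fr_br13 fr) !form1_0.
  have [_ _ _ -> ->] := fr_X3 fr x; have [_ _ _ -> ->] := fr_Y2 fr x; ring.
rewrite left_slot (d2C23 _ X1 Y1 W) (d2C23 _ X1 Y2 W) (left_slot W Y1).
rewrite (left_slot W Y2) (d2_self psi X1 Y1) (d2_self psi X1 Y2).
have [_ _ _ -> _] := fr_Y1 fr x; have [_ _ _ -> _] := fr_Y2 fr x.
rewrite (d2C23 _ X1 Y2) -[d2 _ X1 Y1 Y2 x]/(coefY2 x); ring.
Qed.

(** d psi (X2, ., .) = e3 /\ z2 - c1 (z1 /\ z2): the first term comes from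
    [X2, X3] = - Y1, the second is the definition of c1 = [coefY1]. *)
Lemma psi_d2_X2 V W x : d2 psi X2 V W x =
  e3 x (V x) * z2 x (W x) - z2 x (V x) * e3 x (W x) -
  coefY1 x * (z1 x (V x) * z2 x (W x) - z2 x (V x) * z1 x (W x)).
Proof.
have left_slot V' W' : d2 psi X2 V' W' x = e3 x (V' x) * z2 x (W' x) +
    (z1 x (V' x) * d2 psi X2 Y1 W' x + z2 x (V' x) * d2 psi X2 Y2 W' x).
  rewrite d2_expand (psi_d2_dist2 _ _ dist2_X2 dist2_X1).
  rewrite (psi_d2_dist2 _ _ dist2_X2 dist2_X2) (psi_d2_dist2 _ _ dist2_X2 dist2_X3).
  rewrite bracket_self (bracketC X2 X1).
  rewrite (fr_br12 fr) (fr_br23 fr) !form1N !form1_0.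
  have [_ _ _ -> ->] := fr_X3 fr x; have [_ _ _ -> ->] := fr_Y1 fr x; ring.
rewrite left_slot (d2C23 _ X2 Y1 W) (d2C23 _ X2 Y2 W) (left_slot W Y1).
rewrite (left_slot W Y2) (d2_self psi X2 Y1) (d2_self psi X2 Y2).
have [_ _ _ _ ->] := fr_Y1 fr x; have [_ _ _ _ ->] := fr_Y2 fr x.
rewrite (d2C23 _ X2 Y2) -[d2 _ X2 Y1 Y2 x]opprK.
rewrite -[- d2 _ X2 Y1 Y2 x]/(coefY1 x); ring.
Qed.

End AdaptedFrame.

(** * The one-form attached to a grading *)

Section GradingTheta.
Context {R : realType} {n : nat} {M : manifold R n} {E : subspace_field M}
  {g : metric E} {o : orientation E} {J : rotation g o} {phi : eform E}
  (fr : adapted_frame J phi).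

Local Notation X1 := (frX1 fr).
Local Notation X2 := (frX2 fr).
Local Notation X3 := (frX3 fr).
Local Notation Y1 := (frY1 fr).
Local Notation Y2 := (frY2 fr).
Local Notation e1 := (fre1 fr).
Local Notation e2 := (fre2 fr).
Local Notation e3 := (fre3 fr).
Local Notation z1 := (frz1 fr).
Local Notation z2 := (frz2 fr).

Implicit Types (U V W A B : vfield M) (x : M).

Lemma dist2_expand x v : dist2 E x v ->
  v = e1 x v *: X1 x + (e2 x v *: X2 x + e3 x v *: X3 x).
Proof.
move=> /(fr_dist2 fr)[v1 v2].
by rewrite {1}[v](fr_expand fr) v1 v2 !scale0r !addr0.
Qed.

Lemma e3_E x v : E x v -> e3 x v = 0.
Proof. by move=> /(fr_E fr)[]. Qed.

Lemma dist2_E x (v : tangent x) : dist2 E x v -> e3 x v = 0 -> E x v.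
Proof. by move=> /(fr_dist2 fr)[v1 v2] v3; apply/(fr_E fr). Qed.

Section OneGrading.
Context (I : grading M) (egI : is_egrading E I).

Lemma grading_split x v : exists w : tangent x * tangent x * tangent x,
  [/\ gr3 I x w.1.1, gr2 I x w.1.2, E x w.2 & v = w.1.1 + w.1.2 + w.2].
Proof.
by have [<- _ _ dec _] := egI; have [w [wP _]] := dec x v; exists w.
Qed.

Lemma grading_uniq x (a a' b b' c c' : tangent x) :
  gr3 I x a -> gr3 I x a' -> gr2 I x b -> gr2 I x b' -> E x c -> E x c' ->
  a + b + c = a' + b' + c' -> [/\ a = a', b = b' & c = c'].
Proof.
have [E1 _ _ dec _] := egI; rewrite -E1 => ga ga' gb gb' gc gc' eqs.
have [w [_ wU]] := dec x (a + b + c).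
have wE : w = (a, b, c) by exact: wU.
have : w = (a', b', c') by exact: wU.
by rewrite wE => -[].
Qed.

Lemma gr2_dist2 x v : gr2 I x v -> dist2 E x v.
Proof.
have [E1 _ _ _ D2] := egI => gv; apply/D2; exists v, 0.
by rewrite E1 addr0; split=> //; exact: subspace0.
Qed.

Lemma dist2_split x v : dist2 E x v -> exists b c, [/\ gr2 I x b, E x c & v = b + c].
Proof. by have [<- _ _ _ D2] := egI => /D2. Qed.

Definition component x (v : tangent x) := projT1 (cid (grading_split v)).

Lemma componentP x (v : tangent x) : [/\ gr3 I x (component v).1.1,
  gr2 I x (component v).1.2, E x (component v).2 &
  v = (component v).1.1 + (component v).1.2 + (component v).2].
Proof. exact: (projT2 (cid (grading_split v))). Qed.

(** As theta X3 = 1 and theta vanishes on E and in degree -3, theta can only be the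
    e3-coordinate of the component of degree -2. *)
Definition theta_fun x (v : tangent x) : R := e3 x (component v).1.2.

Lemma theta_funE x (a b c : tangent x) : gr3 I x a -> gr2 I x b -> E x c ->
  theta_fun (a + b + c) = e3 x b.
Proof.
move=> ga gb Ec; rewrite /theta_fun.
have [ga' gb' Ec' eqs] := componentP (a + b + c).
by have [_ <- _] := grading_uniq ga ga' gb gb' Ec Ec' eqs.
Qed.

Fact theta_fun_lin x : scalar (@theta_fun x).
Proof.
move=> k u v; rewrite /theta_fun -form1_lin.
have [u3 u2 u1 uE] := componentP u; have [v3 v2 v1 vE] := componentP v.
rewrite -[LHS]/(theta_fun (k *: u + v)) {1}uE {1}vE.
rewrite !scalerDr (addrACA (_ + _)) (addrACA (_ *: _)).
by apply: theta_funE; apply: (dist_subspace _ x).2.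
Qed.

Lemma sum_frame k (W : 'I_k -> vfield M) (a : 'I_(k + 3) -> R) x :
  \sum_i a i *: (match fintype.split i with
                 | inl j => W j
                 | inr j => tnth [tuple X1; X2; X3] j end) x =
  \sum_j a (lshift 3 j) *: W j x +
    (a (rshift k ord0) *: X1 x + (a (rshift k (lift ord0 ord0)) *: X2 x +
     a (rshift k (lift ord0 (lift ord0 ord0))) *: X3 x)).
Proof.
rewrite big_split_ord /= !big_ord_recl big_ord0 addr0.
congr (_ + _); last by rewrite !(unsplitK (inr _)).
by apply: eq_bigr => j _; rewrite (unsplitK (inl j)).
Qed.

(** Near each point a frame W of the degree -3 part completes X1, X2, X3 to a
    frame of the tangent bundle, and theta is the coordinate along X3 in it. *)
Fact theta_fun_smooth (X : vfield M) : smooth (fun x => theta_fun (X x)).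
Proof.
have [_ [k sub3] _ _ _] := egI; apply: smooth_quotient => x.
have [W nearW] := sub3 x.
pose F (i : 'I_(k + 3)) := match fintype.split i with
  | inl j => W j | inr j => tnth [tuple X1; X2; X3] j end.
have /choice[d dP] : forall y, exists a : 'I_k -> R,
    is_basis (gr3 I y) (fun i => W i y) ->
    (component (X y)).1.1 = \sum_j a j *: W j y.
  move=> y; have [gy _ _ _] := componentP (X y).
  have [WB|nWB] := pselect (is_basis (gr3 I y) (fun i => W i y)).
    by have [/(_ (component (X y)).1.1)[/(_ gy) [a ->] _] _] := WB; exists a.
  by exists (fun=> 0) => /nWB.
pose r y := (component (X y)).1.2 + (component (X y)).2.
have rD y : dist2 E y (r y).
  have [_ g2 g1 _] := componentP (X y).
  by apply: subspaceD; [exact: gr2_dist2|exact: (E_dist2 fr)].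
pose c (i : 'I_(k + 3)) y := match fintype.split i with
  | inl j => d y j
  | inr j => tnth [tuple e1 y (r y); e2 y (r y); e3 y (r y)] j end.
have free : free_at F x.
  have WB := nbhs_singleton nearW; move=> a; rewrite sum_frame.
  set u := \sum_j _; set v := (X in _ + X) => uv.
  have u3 : gr3 I x u by apply/WB.1; exists (fun j => a (lshift 3 j)).
  have vD : dist2 E x v.
    do 2![apply: (dist_subspace (dist2 E) x).2;
          first by [exact: dist2_X1|exact: dist2_X2]].
    by apply: subspaceZ; exact: dist2_X3.
  have [b [b' [gb Eb' vE]]] := dist2_split vD.
  have [u0 b0 b'0] : [/\ u = 0, b = 0 & b' = 0].
    apply: (@grading_uniq x); do ?by [|exact: subspace0].
    by rewrite -addrA -vE uv !addr0.
  have v0 : v = 0 by rewrite vE b0 b'0 addr0.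
  have := fr_X1 fr x; have := fr_X2 fr x; have := fr_X3 fr x.
  move=> [p1 p2 p3 _ _] [q1 q2 q3 _ _] [s1 s2 s3 _ _].
  have := congr1 (e1 x) v0; have := congr1 (e2 x) v0; have := congr1 (e3 x) v0.
  rewrite !form1_lin !form1Z !form1_0 p1 p2 p3 q1 q2 q3 s1 s2 s3.
  rewrite !mulr0 !mulr1 !add0r !addr0 => a3 a2 a1 i.
  case: (split_ordP i) => j ->; first exact: (WB.2 (fun j => a (lshift 3 j)) u0).
  case: (unliftP ord0 j) => [j'|] -> //.
  case: (unliftP ord0 j') => [j''|] -> //.
  by rewrite (ord1 j'').
have near_c : \forall y \near x, X y = \sum_i c i y *: F i y.
  apply: filterS nearW => y WB; rewrite sum_frame /c !(unsplitK (inr _)) /=.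
  under eq_bigr do rewrite (unsplitK (inl _)).
  rewrite -(dP y WB) !(tnth_nth 0) /= -dist2_expand //.
  by have [_ _ _ {1}->] := componentP (X y); rewrite /r addrA.
have [a [b [bx ab]]] :=
  smooth_coordinates free near_c (rshift k (lift ord0 (lift ord0 ord0))).
exists a, b; split=> //; apply: filterS ab => y <-; congr (_ * _).
rewrite /c (unsplitK (inr _)) (tnth_nth 0) /= /r form1D.
by have [_ _ /e3_E-> _] := componentP (X y); rewrite addr0.
Qed.

Definition grading_theta : form1 M := Form1 theta_fun_lin theta_fun_smooth.

Lemma grading_theta_dist2 x v : dist2 E x v -> grading_theta x v = e3 x v.
Proof.
move=> /dist2_split[b [c [gb Ec ->]]].
rewrite -[b]add0r [LHS](theta_funE (subspace0 _ x) gb Ec) add0r form1D.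
by rewrite (e3_E Ec) addr0.
Qed.

Lemma grading_theta_is_theta : is_theta J I grading_theta.
Proof.
have [E1 _ _ _ _] := egI; split=> [x v|U V x EU EV].
  split=> [th0|[a [b [ga]]]].
    have [ga gb Ec vE] := componentP v.
    have b0 : (component v).1.2 = 0.
      have Eb : E x (component v).1.2 by exact: (dist2_E (gr2_dist2 gb) th0).
      have [] // := grading_uniq (subspace0 _ x) (subspace0 _ x) gb (subspace0 _ x)
                 (subspace0 _ x) Eb.
      by rewrite !add0r addr0.
    exists (component v).1.1, (component v).2.
    by rewrite E1; split=> //; rewrite {1}vE b0 addr0.
  rewrite E1 => Eb ->; rewrite -[a]addr0.
  by rewrite [LHS](theta_funE ga (subspace0 _ x) Eb) form1_0.
rewrite (d1_E (fr := fr)) //; last 2 first.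
- by move=> y; rewrite grading_theta_dist2; [apply: e3_E; exact: E_X1|exact: dist2_X1].
- by move=> y; rewrite grading_theta_dist2; [apply: e3_E; exact: E_X2|exact: dist2_X2].
rewrite grading_theta_dist2; last exact: dist2_X3.
by have [_ _ -> _ _] := fr_X3 fr x; rewrite mul1r (fr_gJ fr).
Qed.

(** The value on X3 comes from the normalization of d theta, tested on X1, X2. *)
Lemma is_theta_values theta : is_theta J I theta -> forall x,
  [/\ theta x (X1 x) = 0, theta x (X2 x) = 0, theta x (X3 x) = 1 &
      forall v, gr3 I x v -> theta x v = 0].
Proof.
have [E1 _ _ _ _] := egI; move=> [ker dth].
have tE x v : E x v -> theta x v = 0.
  move=> Ev; apply/ker; exists 0, v; rewrite E1 add0r; split=> //.
  exact: subspace0.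
have t1 y : theta y (X1 y) = 0 by apply: tE; exact: E_X1.
have t2 y : theta y (X2 y) = 0 by apply: tE; exact: E_X2.
move=> x; split=> //; last first.
  move=> v gv; apply/ker; exists v, 0; rewrite addr0; split=> //.
  exact: subspace0.
have := dth X1 X2 x (E_X1 fr x) (E_X2 fr x).
rewrite (d1_X12 t1 t2) (fr_gJ fr (E_X1 fr x) (E_X2 fr x)).
have [-> -> _ _ _] := fr_X1 fr x; have [-> -> _ _ _] := fr_X2 fr x.
by rewrite mul0r mulr1 sub0r => /oppr_inj.
Qed.

Lemma is_theta_uniq theta theta' :
  is_theta J I theta -> is_theta J I theta' -> theta = theta'.
Proof.
move=> /is_theta_values tP /is_theta_values tP'; apply: form1_ext => x v.
have [t1 t2 t3 t4] := tP x; have [t1' t2' t3' t4'] := tP' x.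
have [ga gb Ec ->] := componentP v.
have eq2 u : dist2 E x u -> theta x u = theta' x u.
  by move=> /dist2_expand->; rewrite !form1_lin !form1Z t1 t2 t3 t1' t2' t3'.
rewrite -addrA !form1D t4 // t4' //.
rewrite (eq2 (component v).1.2) ?(eq2 (component v).2) //.
  exact: (E_dist2 fr).
exact: gr2_dist2.
Qed.

End OneGrading.

End GradingTheta.

(** * The canonical grading *)

Section CanonicalGrading.
Context {R : realType} {n : nat} {M : manifold R n} {E : subspace_field M}
  {g : metric E} {o : orientation E} {J : rotation g o} {phi : eform E}
  (fr : adapted_frame J phi).

Local Notation X1 := (frX1 fr).
Local Notation X2 := (frX2 fr).
Local Notation X3 := (frX3 fr).
Local Notation Y1 := (frY1 fr).
Local Notation Y2 := (frY2 fr).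
Local Notation e1 := (fre1 fr).
Local Notation e2 := (fre2 fr).
Local Notation e3 := (fre3 fr).
Local Notation z1 := (frz1 fr).
Local Notation z2 := (frz2 fr).

Implicit Types (U V W A B : vfield M) (x : M).

Context (psi : form2 M)
  (psiE : forall x u v, psi x u v = z1 x u * z2 x v - z2 x u * z1 x v).

Local Notation coefY1 := (coefY1 fr psi).
Local Notation coefY2 := (coefY2 fr psi).

(** The form that condition (i) leaves as the only candidate for theta. *)
Definition theta0 : form1 M :=
  form1_comb (- coefY1) z1 (form1_comb (- coefY2) z2 e3).
Definition lam1 : form1 M := contract_d1 fr theta0 X1.
Definition lam2 : form1 M := contract_d1 fr theta0 X2.

Lemma theta0E x v : theta0 x v = e3 x v - coefY1 x * z1 x v - coefY2 x * z2 x v.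
Proof.
by rewrite -[LHS]/(- coefY1 x * z1 x v + (- coefY2 x * z2 x v + e3 x v)); ring.
Qed.

Lemma theta0_E x v : E x v -> theta0 x v = 0.
Proof. by move=> /(fr_E fr)[v1 v2 v3]; rewrite theta0E v1 v2 v3; ring. Qed.

Lemma theta0_X3 x : theta0 x (X3 x) = 1.
Proof. by rewrite theta0E; have [_ _ -> -> ->] := fr_X3 fr x; ring. Qed.

Lemma d1_theta0_E U V x : E x (U x) -> E x (V x) ->
  d1 theta0 U V x = e2 x (U x) * e1 x (V x) - e1 x (U x) * e2 x (V x).
Proof.
move=> EU EV; rewrite (d1_E (fr := fr)) // ?theta0_X3 ?mul1r //.
- by move=> y; apply: theta0_E; exact: E_X1.
- by move=> y; apply: theta0_E; exact: E_X2.
Qed.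

Lemma lam1_d1 V x : lam1 x (V x) = d1 theta0 X1 V x.
Proof. exact: contract_d1E. Qed.

Lemma lam2_d1 V x : lam2 x (V x) = d1 theta0 X2 V x.
Proof. exact: contract_d1E. Qed.

Lemma lam1_E x v : E x v -> lam1 x v = - e2 x v.
Proof.
have [V <-] := field_through fr v => EV; rewrite lam1_d1 d1_theta0_E //.
  by have [-> -> _ _ _] := fr_X1 fr x; ring.
exact: E_X1.
Qed.

Lemma lam2_E x v : E x v -> lam2 x v = e1 x v.
Proof.
have [V <-] := field_through fr v => EV; rewrite lam2_d1 d1_theta0_E //.
  by have [-> -> _ _ _] := fr_X2 fr x; ring.
exact: E_X2.
Qed.

(** In degree -3 condition (ii) adds lam1 = lam2 = 0 to the equation theta = 0; in
    degree -2 it adds them to the equations z1 = z2 = 0 of E^-2. *)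
Definition canonical_gr3 : subspace_field M :=
  cap_field (ker_form theta0) (cap_field (ker_form lam1) (ker_form lam2)).
Definition canonical_gr2 : subspace_field M :=
  cap_field (cap_field (ker_form z1) (ker_form z2))
            (cap_field (ker_form lam1) (ker_form lam2)).
Definition canonical_grading : grading M := Grading canonical_gr3 canonical_gr2 E.

Lemma gr3P x v : canonical_gr3 x v ->
  [/\ theta0 x v = 0, lam1 x v = 0 & lam2 x v = 0].
Proof. by case=> t0 [l1 l2]; split. Qed.

Lemma gr2P x v : canonical_gr2 x v ->
  [/\ z1 x v = 0, z2 x v = 0, lam1 x v = 0 & lam2 x v = 0].
Proof. by case=> -[v1 v2] [l1 l2]; split. Qed.

Lemma mem_gr3 x v : theta0 x v = 0 -> lam1 x v = 0 -> lam2 x v = 0 ->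
  canonical_gr3 x v.
Proof. by move=> t0 l1 l2; split; [exact: t0|split; [exact: l1|exact: l2]]. Qed.

Lemma mem_gr2 x v : z1 x v = 0 -> z2 x v = 0 -> lam1 x v = 0 -> lam2 x v = 0 ->
  canonical_gr2 x v.
Proof.
move=> v1 v2 l1 l2; split; first by split; [exact: v1|exact: v2].
by split; [exact: l1|exact: l2].
Qed.

(** With theta0 in place of e3, and lam2, - lam1 in place of e1, e2, the dual
    coframe of the adapted frame remains a coframe. *)
Lemma canonical_coframe0 x v : theta0 x v = 0 -> z1 x v = 0 -> z2 x v = 0 ->
  lam1 x v = 0 -> lam2 x v = 0 -> v = 0.
Proof.
move=> t0 v1 v2 l1 l2.
have v3 : e3 x v = 0 by move: t0; rewrite theta0E v1 v2 !mulr0 !subr0.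
have Ev : E x v by apply/(fr_E fr).
move: l1 l2; rewrite lam1_E // lam2_E // => /eqP; rewrite oppr_eq0 => /eqP l1 l2.
by rewrite [v](E_expand fr Ev) l1 l2 !scale0r addr0.
Qed.

(** Projection along E onto the common kernel of lam1 and lam2; it carries X3 and
    the corrected Y1, Y2 to the rest of the frame dual to the new coframe. *)
Definition project_lam V : vfield M :=
  vfield_comb (- form1_app lam2 V) X1 (vfield_comb (form1_app lam1 V) X2 V).
Definition frZ : vfield M := project_lam X3.
Definition frW1 : vfield M := project_lam (vfield_comb coefY1 X3 Y1).
Definition frW2 : vfield M := project_lam (vfield_comb coefY2 X3 Y2).

Lemma form1_project (a : form1 M) V x : a x (project_lam V x) =
  a x (V x) - lam2 x (V x) * a x (X1 x) + lam1 x (V x) * a x (X2 x).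
Proof.
rewrite -[project_lam V x]/(- lam2 x (V x) *: X1 x + (lam1 x (V x) *: X2 x + V x)).
rewrite !form1_lin; ring.
Qed.

Lemma lam_project V x :
  lam1 x (project_lam V x) = 0 /\ lam2 x (project_lam V x) = 0.
Proof.
rewrite !form1_project !(lam1_E (E_X1 fr x)) !(lam1_E (E_X2 fr x)).
rewrite !(lam2_E (E_X1 fr x)) !(lam2_E (E_X2 fr x)).
have [-> -> _ _ _] := fr_X1 fr x; have [-> -> _ _ _] := fr_X2 fr x.
by split; ring.
Qed.

Lemma project_E (a : form1 M) V x : (forall v, E x v -> a x v = 0) ->
  a x (project_lam V x) = a x (V x).
Proof.
move=> aE; rewrite form1_project (aE (X1 x)) ?(aE (X2 x)); first by ring.
  exact: E_X2.
exact: E_X1.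
Qed.

Lemma z1_E x v : E x v -> z1 x v = 0. Proof. by move=> /(fr_E fr)[]. Qed.
Lemma z2_E x v : E x v -> z2 x v = 0. Proof. by move=> /(fr_E fr)[]. Qed.

Lemma frZP x : [/\ theta0 x (frZ x) = 1, z1 x (frZ x) = 0, z2 x (frZ x) = 0,
  lam1 x (frZ x) = 0 & lam2 x (frZ x) = 0].
Proof.
have [l1 l2] := lam_project X3 x; split=> //.
- by rewrite project_E ?theta0_X3 //; exact: theta0_E.
- by rewrite project_E; [have [] := fr_X3 fr x|exact: z1_E].
- by rewrite project_E; [have [] := fr_X3 fr x|exact: z2_E].
Qed.

Lemma frW1P x : [/\ theta0 x (frW1 x) = 0, z1 x (frW1 x) = 1, z2 x (frW1 x) = 0,
  lam1 x (frW1 x) = 0 & lam2 x (frW1 x) = 0].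
Proof.
have [l1 l2] := lam_project (vfield_comb coefY1 X3 Y1) x; split=> //.
- rewrite project_E; last exact: theta0_E.
  rewrite form1_lin theta0_X3 theta0E.
  by have [_ _ -> -> ->] := fr_Y1 fr x; ring.
- rewrite project_E; last exact: z1_E.
  rewrite form1_lin; have [_ _ _ -> _] := fr_X3 fr x.
  by have [_ _ _ -> _] := fr_Y1 fr x; ring.
- rewrite project_E; last exact: z2_E.
  rewrite form1_lin; have [_ _ _ _ ->] := fr_X3 fr x.
  by have [_ _ _ _ ->] := fr_Y1 fr x; ring.
Qed.

Lemma frW2P x : [/\ theta0 x (frW2 x) = 0, z1 x (frW2 x) = 0, z2 x (frW2 x) = 1,
  lam1 x (frW2 x) = 0 & lam2 x (frW2 x) = 0].
Proof.
have [l1 l2] := lam_project (vfield_comb coefY2 X3 Y2) x; split=> //.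
- rewrite project_E; last exact: theta0_E.
  rewrite form1_lin theta0_X3 theta0E.
  by have [_ _ -> -> ->] := fr_Y2 fr x; ring.
- rewrite project_E; last exact: z1_E.
  rewrite form1_lin; have [_ _ _ -> _] := fr_X3 fr x.
  by have [_ _ _ -> _] := fr_Y2 fr x; ring.
- rewrite project_E; last exact: z2_E.
  rewrite form1_lin; have [_ _ _ _ ->] := fr_X3 fr x.
  by have [_ _ _ _ ->] := fr_Y2 fr x; ring.
Qed.

Lemma gr3_expand x v : canonical_gr3 x v ->
  v = z1 x v *: frW1 x + z2 x v *: frW2 x.
Proof.
move=> /gr3P[t0 l1 l2]; apply/eqP; rewrite -subr_eq0; apply/eqP.
have [a1 a2 a3 a4 a5] := frW1P x; have [b1 b2 b3 b4 b5] := frW2P x.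
by apply: canonical_coframe0;
  rewrite form1D form1N form1_lin form1Z ?t0 ?l1 ?l2
    ?a1 ?a2 ?a3 ?a4 ?a5 ?b1 ?b2 ?b3 ?b4 ?b5; ring.
Qed.

Lemma gr2_expand x v : canonical_gr2 x v -> v = theta0 x v *: frZ x.
Proof.
move=> /gr2P[v1 v2 l1 l2]; apply/eqP; rewrite -subr_eq0; apply/eqP.
have [a1 a2 a3 a4 a5] := frZP x.
by apply: canonical_coframe0;
  rewrite form1D form1N form1Z ?a1 ?a2 ?a3 ?a4 ?a5 ?v1 ?v2 ?l1 ?l2; ring.
Qed.

Lemma gr3_W1 x : canonical_gr3 x (frW1 x).
Proof. by have [t _ _ l1 l2] := frW1P x; exact: mem_gr3. Qed.
Lemma gr3_W2 x : canonical_gr3 x (frW2 x).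
Proof. by have [t _ _ l1 l2] := frW2P x; exact: mem_gr3. Qed.
Lemma gr2_Z x : canonical_gr2 x (frZ x).
Proof. by have [_ v1 v2 l1 l2] := frZP x; exact: mem_gr2. Qed.

Lemma canonical_decomposition x v : v = (z1 x v *: frW1 x + z2 x v *: frW2 x) +
  theta0 x v *: frZ x + (lam2 x v *: X1 x - lam1 x v *: X2 x).
Proof.
apply/eqP; rewrite -subr_eq0; apply/eqP.
have [a1 a2 a3 a4 a5] := frW1P x; have [b1 b2 b3 b4 b5] := frW2P x.
have [c1 c2 c3 c4 c5] := frZP x; have [EX1 EX2] := (E_X1 fr x, E_X2 fr x).
have [p1 p2 _ _ _] := fr_X1 fr x; have [q1 q2 _ _ _] := fr_X2 fr x.
move: (frW1 x) (frW2 x) (frZ x) a1 a2 a3 a4 a5 b1 b2 b3 b4 b5 c1 c2 c3 c4 c5.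
move=> w1 w2 z a1 a2 a3 a4 a5 b1 b2 b3 b4 b5 c1 c2 c3 c4 c5.
apply: canonical_coframe0; rewrite -scaleNr !(form1D, form1N, form1Z).
- by rewrite a1 b1 c1 (theta0_E EX1) (theta0_E EX2); ring.
- by rewrite a2 b2 c2 (z1_E EX1) (z1_E EX2); ring.
- by rewrite a3 b3 c3 (z2_E EX1) (z2_E EX2); ring.
- by rewrite a4 b4 c4 (lam1_E EX1) (lam1_E EX2) p2 q2; ring.
- by rewrite a5 b5 c5 (lam2_E EX1) (lam2_E EX2) p1 q1; ring.
Qed.

Lemma canonical_uniq x a b c : canonical_gr3 x a -> canonical_gr2 x b -> E x c ->
  a + b + c = 0 -> [/\ a = 0, b = 0 & c = 0].
Proof.
move=> ga gb Ec abc; have [ta l1a l2a] := gr3P ga.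
have [v1b v2b l1b l2b] := gr2P gb.
have val (f : form1 M) : f x a + f x b + f x c = 0.
  by rewrite -!form1D abc form1_0.
have a0 : a = 0.
  apply: canonical_coframe0 => //.
    by have := val z1; rewrite v1b (z1_E Ec) !addr0.
  by have := val z2; rewrite v2b (z2_E Ec) !addr0.
have b0 : b = 0.
  apply: canonical_coframe0 => //.
  by have := val theta0; rewrite ta (theta0_E Ec) add0r addr0.
by split=> //; move: abc; rewrite a0 b0 !add0r.
Qed.

Lemma grading_ext (I I' : grading M) :
  gr3 I = gr3 I' -> gr2 I = gr2 I' -> gr1 I = gr1 I' -> I = I'.
Proof. by case: I I' => [? ? ?] [? ? ?] /= -> -> ->. Qed.

Lemma canonical_split x v : exists a b c,
  [/\ canonical_gr3 x a, canonical_gr2 x b, E x c & v = a + b + c].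
Proof.
exists (z1 x v *: frW1 x + z2 x v *: frW2 x), (theta0 x v *: frZ x).
exists (lam2 x v *: X1 x - lam1 x v *: X2 x); split.
- apply: (dist_subspace canonical_gr3 x).2; first exact: gr3_W1.
  by apply: (@subspaceZ _ _ _ canonical_gr3); exact: gr3_W2.
- by apply: (@subspaceZ _ _ _ canonical_gr2); exact: gr2_Z.
- by apply: subspaceB; apply: subspaceZ; [exact: E_X1|exact: E_X2].
- exact: canonical_decomposition.
Qed.

Lemma canonical_gr3_subbundle : is_subbundle canonical_gr3 2.
Proof.
move=> x; exists (fun i => tnth [tuple frW1; frW2] i); apply: nearW => y.
have [gW1 gW2] := (gr3_W1 y, gr3_W2 y).
have [_ a2 a3 _ _] := frW1P y; have [_ b2 b3 _ _] := frW2P y.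
have sumE (a : 'I_2 -> R) : \sum_i a i *: tnth [tuple frW1; frW2] i y =
    a ord0 *: frW1 y + a (lift ord0 ord0) *: frW2 y.
  by rewrite !big_ord_recl big_ord0 addr0.
have expand v : canonical_gr3 y v -> v = z1 y v *: frW1 y + z2 y v *: frW2 y.
  exact: gr3_expand.
split=> [v|a]; last first.
  rewrite sumE; move: (frW1 y) (frW2 y) a2 a3 b2 b3 => w1 w2 a2 a3 b2 b3 a0 i.
  have := congr1 (z1 y) a0; have := congr1 (z2 y) a0.
  rewrite !form1_lin !form1Z !form1_0 a2 a3 b2 b3 !mulr0 !mulr1 add0r addr0 => r2 r1.
  case: (unliftP ord0 i) => [i'|] -> //.
  by rewrite (ord1 i').
split=> [gv|[a ->]].
  by exists (fun i => tnth [tuple z1 y v; z2 y v] i); rewrite sumE; exact: expand.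
rewrite sumE; apply: (dist_subspace canonical_gr3 y).2 => //.
exact: (@subspaceZ _ _ _ canonical_gr3).
Qed.

Lemma canonical_gr2_subbundle : is_subbundle canonical_gr2 1.
Proof.
move=> x; exists (fun=> frZ); apply: nearW => y.
have sumE (a : 'I_1 -> R) : \sum_i a i *: frZ y = a ord0 *: frZ y.
  by rewrite big_ord1.
split=> [v|a].
  split=> [gv|[a ->]].
    by exists (fun=> theta0 y v); rewrite sumE; exact: gr2_expand.
  by rewrite sumE; apply: (@subspaceZ _ _ _ canonical_gr2); exact: gr2_Z.
rewrite sumE => a0 i; rewrite (ord1 i).
have := congr1 (theta0 y) a0; rewrite form1Z form1_0.
by have [-> _ _ _ _] := frZP y; rewrite mulr1.
Qed.

Lemma canonical_is_egrading : is_egrading E canonical_grading.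
Proof.
split=> //.
- by exists 2; exact: canonical_gr3_subbundle.
- by exists 1; exact: canonical_gr2_subbundle.
- move=> x v; have [a [b [c [ga gb Ec vE]]]] := canonical_split v.
  exists (a, b, c); split=> [//|[[a' b'] c'] [ga' gb' Ec' vE']].
  have [] := @canonical_uniq x (a - a') (b - b') (c - c').
  + exact: (subspaceB ga ga').
  + exact: (subspaceB gb gb').
  + exact: (subspaceB Ec Ec').
  + rewrite (addrACA a) -opprD (addrACA (a + b)) -opprD -vE.
    by rewrite vE' subrr.
  by move=> /subr0_eq-> /subr0_eq-> /subr0_eq->.
- move=> x v; split=> [Dv|[a [b [/gr2P[a1 a2 _ _] Eb ->]]]]; last first.
    by apply/(fr_dist2 fr); rewrite !form1D a1 a2 (z1_E Eb) (z2_E Eb) addr0.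
  have [v1 v2] := (fr_dist2 fr _).1 Dv.
  exists (theta0 x v *: frZ x), (lam2 x v *: X1 x - lam1 x v *: X2 x); split.
  + by apply: (@subspaceZ _ _ _ canonical_gr2); exact: gr2_Z.
  + by apply: subspaceB; apply: subspaceZ; [exact: E_X1|exact: E_X2].
  + by rewrite {1}[v]canonical_decomposition v1 v2 !scale0r !add0r.
Qed.

Lemma theta0_is_theta : is_theta J canonical_grading theta0.
Proof.
split=> [x v|U V x EU EV]; last by rewrite d1_theta0_E // (fr_gJ fr).
split=> [t0|[a [b [/gr3P[ta _ _] Eb ->]]]].
  exists (z1 x v *: frW1 x + z2 x v *: frW2 x),
         (lam2 x v *: X1 x - lam1 x v *: X2 x).
  split.
  - apply: (dist_subspace canonical_gr3 x).2; first exact: gr3_W1.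
    by apply: subspaceZ; exact: gr3_W2.
  - by apply: subspaceB; apply: subspaceZ; [exact: E_X1|exact: E_X2].
  - by rewrite {1}[v]canonical_decomposition t0 scale0r addr0.
by rewrite form1D ta (theta0_E Eb) addr0.
Qed.

(** On the kernel of theta0 one has e3 = c1 z1 + c2 z2, and then both expressions
    for d psi cancel. *)
Lemma canonical_psi U V W x : E x (U x) ->
  canonical_gr3 x (V x) -> canonical_gr3 x (W x) -> d2 psi U V W x = 0.
Proof.
move=> EU /gr3P[tV _ _] /gr3P[tW _ _]; rewrite (d2_expandE fr _ _ _ EU).
rewrite (psi_d2_X1 psiE) (psi_d2_X2 psiE).
have e3V : e3 x (V x) = coefY1 x * z1 x (V x) + coefY2 x * z2 x (V x).
  by move/eqP: tV; rewrite theta0E -addrA -opprD subr_eq0 => /eqP.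
have e3W : e3 x (W x) = coefY1 x * z1 x (W x) + coefY2 x * z2 x (W x).
  by move/eqP: tW; rewrite theta0E -addrA -opprD subr_eq0 => /eqP.
rewrite e3V e3W.
ring.
Qed.

Lemma canonical_d1_theta0 U W x : E x (U x) -> lam1 x (W x) = 0 ->
  lam2 x (W x) = 0 -> d1 theta0 U W x = 0.
Proof.
move=> EU l1 l2; rewrite (d1_expandE fr _ _ EU) -lam1_d1 -lam2_d1.
by rewrite l1 l2; ring.
Qed.

Section Uniqueness.
Context (I : grading M) (egI : is_egrading E I).
Hypothesis condPsi : forall (U W1 W2 : vfield M) x,
  E x (U x) -> gr3 I x (W1 x) -> gr3 I x (W2 x) -> d2 psi U W1 W2 x = 0.

Lemma gr3_lift x v : exists w, [/\ gr3 I x w, z1 x w = z1 x v & z2 x w = z2 x v].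
Proof.
have [[[a b] c] [/= ga gb Ec ->]] := grading_split egI v.
have [b1 b2] := (fr_dist2 fr _).1 (gr2_dist2 egI gb).
by exists a; rewrite !form1D b1 b2 (z1_E Ec) (z2_E Ec) !addr0.
Qed.

(** Condition (i) fixes theta: it computes the components along X3 of the
    vectors of degree -3 that lie over Y1 and Y2 modulo E^-2. *)
Lemma is_theta_theta0 theta : is_theta J I theta -> theta = theta0.
Proof.
move=> /(is_theta_values fr egI) tP; apply: form1_ext => x v.
have [t1 t2 t3 t4] := tP x.
have [w1 [gw1 p1 p2]] := gr3_lift (Y1 x); have [w2 [gw2 q1 q2]] := gr3_lift (Y2 x).
have [_ _ _ r1 r2] := fr_Y1 fr x; have [_ _ _ s1 s2] := fr_Y2 fr x.
move: p1 p2 q1 q2; rewrite r1 r2 s1 s2 => p1 p2 q1 q2.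
have [V1 V1E] := field_through fr w1; have [V2 V2E] := field_through fr w2.
have c1 : e3 x w1 = coefY1 x.
  have := @condPsi X2 V1 V2 x (E_X2 fr x); rewrite V1E V2E => /(_ gw1 gw2).
  rewrite (psi_d2_X2 psiE) V1E V2E p1 p2 q1 q2 !(mul0r, mulr1, subr0).
  by move/subr0_eq.
have c2 : e3 x w2 = coefY2 x.
  have := @condPsi X1 V1 V2 x (E_X1 fr x); rewrite V1E V2E => /(_ gw1 gw2).
  rewrite (psi_d2_X1 psiE) V1E V2E p1 p2 q1 q2.
  rewrite !(mul0r, mulr1, mulr0, subr0, sub0r, mul1r).
  by rewrite addrC => /subr0_eq.
have := t4 _ gw1; have := t4 _ gw2.
rewrite (form1_expand fr theta w1) (form1_expand fr theta w2).
rewrite (form1_expand fr theta v) p1 p2 q1 q2 c1 c2 t1 t2 t3.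
rewrite !(mulr0, add0r, mulr1, mul0r, mul1r, addr0) => y2 y1.
have -> : theta x (Y1 x) = - coefY1 x by apply/eqP; rewrite -addr_eq0 addrC y1.
have -> : theta x (Y2 x) = - coefY2 x by apply/eqP; rewrite -addr_eq0 addrC y2.
rewrite theta0E; ring.
Qed.

(** Once theta = theta0, condition (ii) puts each part of I inside the corresponding
    part of the canonical grading; as both decompose the tangent spaces, the
    inclusions are equalities. *)
Lemma canonical_grading_uniq :
  (forall theta : form1 M, is_theta J I theta -> forall (U W : vfield M) x,
     E x (U x) -> (exists a b, [/\ gr2 I x a, gr3 I x b & W x = a + b]) ->
     d1 theta U W x = 0) ->
  canonical_grading = I.
Proof.
move=> condTheta.
have th0 : is_theta J I theta0.
  have t := grading_theta_is_theta fr egI.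
  by rewrite -(is_theta_theta0 t).
have lam0 x v : (exists a b, [/\ gr2 I x a, gr3 I x b & v = a + b]) ->
    lam1 x v = 0 /\ lam2 x v = 0.
  have [V <-] := field_through fr v => Vab; rewrite lam1_d1 lam2_d1.
  by split; apply: (condTheta _ th0) Vab; [exact: E_X1|exact: E_X2].
have sub3 x v : gr3 I x v -> canonical_gr3 x v.
  move=> gv; have [_ _ _ t4] := is_theta_values fr egI th0 x.
  have [|l1 l2] := lam0 x v; last exact: mem_gr3 (t4 _ gv) l1 l2.
  by exists 0, v; rewrite add0r; split=> //; exact: subspace0.
have sub2 x v : gr2 I x v -> canonical_gr2 x v.
  move=> gv; have [v1 v2] := (fr_dist2 fr _).1 (gr2_dist2 egI gv).
  have [|l1 l2] := lam0 x v; last exact: mem_gr2 v1 v2 l1 l2.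
  by exists v, 0; rewrite addr0; split=> //; exact: subspace0.
have [E1 _ _ _ _] := egI; apply: grading_ext; last by rewrite E1.
  apply: subspace_field_ext => x v; split=> gv; last exact: sub3.
  have [[[a b] c] [/= ga gb Ec vE]] := grading_split egI v.
  have [] := @canonical_uniq x (a - v) b c _ (sub2 _ _ gb) Ec.
  - exact: subspaceB (sub3 _ _ ga) gv.
  - by rewrite (addrAC a) (addrAC (a + b)) -vE subrr.
  by move=> /subr0_eq <-.
apply: subspace_field_ext => x v; split=> gv; last exact: sub2.
have [[[a b] c] [/= ga gb Ec vE]] := grading_split egI v.
have [] := @canonical_uniq x a (b - v) c (sub3 _ _ ga) _ Ec.
- exact: subspaceB (sub2 _ _ gb) gv.
- by rewrite addrA (addrAC (a + b)) -vE subrr.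
by move=> _ /subr0_eq <-.
Qed.

End Uniqueness.

End CanonicalGrading.

(** * Construction of an adapted frame *)

Section FrameConstruction.
Context {R : realType} {n : nat} {M : manifold R n} {E : subspace_field M}
  {g : metric E} {o : orientation E} (J : rotation g o) (phi : eform E).

Lemma nonvanishing_section : is_subbundle E 2 -> trivializable E ->
  exists X : vfield M, forall x, E x (X x) /\ X x != 0.
Proof.
move=> sub2 [[|k] [X XB]]; last first.
  exists (X ord0) => x; split; first exact: (is_basis_mem ord0 (XB x)).
  exact: (is_basis_neq0 ord0 (XB x)).
(* a trivialization of rank zero is possible only over the empty manifold *)
exists vfield_zero => x; exfalso.
have [e /nbhs_singleton eB] := sub2 x.
have [/(_ (e ord0 x)) [/(_ (is_basis_mem ord0 eB)) [a ea] _] _] := XB x.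
by have := is_basis_neq0 ord0 eB; rewrite ea big_ord0 eqxx.
Qed.

Lemma unit_section : is_subbundle E 2 -> trivializable E ->
  exists X : gsection E, forall x, g x (X x) (X x) = 1.
Proof.
move=> sub2 /(nonvanishing_section sub2)[X XE].
pose X' := GSection (fun x => (XE x).1).
have g0 x : 0 < g x (X x) (X x) by have [Ex X0] := XE x; exact: metric_pos.
have sq := smooth_sqrt (metric_smooth g X' X') g0.
have sq0 x : Num.sqrt (g x (X x) (X x)) != 0 by rewrite gt_eqF // sqrtr_gt0.
pose f := Cinf_of (smooth_inv sq sq0).
have YE x : E x (vfield_comb f X vfield_zero x).
  rewrite -[vfield_comb f X vfield_zero x]/(f x *: X x + 0) addr0.
  by apply: subspaceZ; exact: (XE x).1.
exists (GSection YE) => x.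
rewrite -[gsection_field _ x]/(f x *: X x + 0) addr0 metricZ; last 2 first.
- exact: (XE x).1.
- exact: (XE x).1.
rewrite -[f x]/((Num.sqrt (g x (X x) (X x)))^-1).
rewrite -invfM -expr2 sqr_sqrtr ?ltW // mulVf // gt_eqF //.
Qed.

Lemma metricZl x (a : R) u w : E x u -> E x w -> g x (a *: u) w = a * g x u w.
Proof. by move=> Eu Ew; rewrite -{1}[w]scale1r metricZ // mulr1. Qed.

Lemma metricZr x (a : R) u w : E x u -> E x w -> g x w (a *: u) = a * g x w u.
Proof. by move=> Eu Ew; rewrite -{1}[w]scale1r metricZ // mul1r. Qed.

Lemma phi0 x : phi x 0 = 0.
Proof.
have := eform_lin phi (-1) (0 : tangent x) 0.
by rewrite scaler0 addr0 scaleN1r addNr.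
Qed.

Lemma phiZ x (a : R) (v : tangent x) : phi x (a *: v) = a *: phi x v.
Proof. by rewrite -[_ *: v]addr0 eform_lin phi0 addr0. Qed.

Lemma phiN x (v : tangent x) : phi x (- v) = - phi x v.
Proof. by rewrite -scaleN1r phiZ scaleN1r. Qed.

Context (X1 : gsection E) (X1u : forall x, g x (X1 x) (X1 x) = 1)
  (sub2 : is_subbundle E 2) (sub3 : is_subbundle (dist2 E) 3)
  (phiP : is_phi J phi).

Implicit Types (x : M).

Let X2 : gsection E := rot_app J X1.

Let E1 x : E x (X1 x). Proof. exact: gsectionP. Qed.
Let E2 x : E x (X2 x). Proof. exact: gsectionP. Qed.

Let E12 x (a b : R) : E x (a *: X1 x + b *: X2 x).
Proof. by apply: (dist_subspace E x).2 => //; exact: subspaceZ. Qed.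

Lemma metric_frame x (a b c d : R) :
  g x (a *: X1 x + b *: X2 x) (c *: X1 x + d *: X2 x) = a * c + b * d.
Proof.
have [_ g12 g22] := rot_unit J (E1 x) (X1u x).
have EbX : E x (b *: X2 x) by exact: subspaceZ.
have EdX : E x (d *: X2 x) by exact: subspaceZ.
rewrite metric_lin // !metric_linr // !(metricZl b, metricZr d) //.
rewrite (Defs.metric_sym g (E2 x) (E1 x)) X1u g12 g22; ring.
Qed.

Lemma E_basis x : is_basis (E x) (fun i => tnth [tuple X1 x; X2 x] i).
Proof.
have [e /nbhs_singleton eB] := sub2 x.
apply: (free_is_basis eB) => [i|a].
  by case: (unliftP ord0 i) => [j|] -> //=; rewrite (ord1 j).
rewrite !big_ord_recl big_ord0 addr0 => a0 i.
have := metric_frame x (a ord0) (a (lift ord0 ord0)) (a ord0) (a (lift ord0 ord0)).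
rewrite (_ : _ + _ = 0); last exact: a0.
rewrite metric0l; last by exact: dist0.
move=> /esym/eqP; rewrite paddr_eq0 -?expr2 ?sqr_ge0 // !sqrf_eq0.
move=> /andP[/eqP a00 /eqP a01].
by case: (unliftP ord0 i) => [j|] -> //=; rewrite (ord1 j).
Qed.

Lemma E_span x v : E x v -> v = g x v (X1 x) *: X1 x + g x v (X2 x) *: X2 x.
Proof.
move=> /(E_basis x).1[a]; rewrite !big_ord_recl big_ord0 addr0.
set b := a ord0; set c := a _ => vE.
have vE' : v = b *: X1 x + c *: X2 x by [].
have := metric_frame x b c 1 0; have := metric_frame x b c 0 1.
rewrite -vE' !scale0r !scale1r addr0 add0r !mulr0 !mulr1 addr0 add0r.
by move=> -> ->.
Qed.

(** J X2 is a unit vector orthogonal to X2, hence X1 or - X1, and the orientation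
    decides. *)
Lemma rot_X2 x : J x (X2 x) = - X1 x.
Proof.
have [or12 g12 g22] := rot_unit J (E1 x) (X1u x).
have [or23 g23 g33] := rot_unit J (E2 x) g22.
have EJ : E x (J x (X2 x)) by exact: rot_E.
have JE := E_span EJ.
rewrite (Defs.metric_sym g EJ (E2 x)) g23 scale0r addr0 in JE.
move: (g x _ _) JE => s JE.
have s1 : s * s = 1.
  have := metric_frame x s 0 s 0; rewrite !scale0r !addr0 -JE g33 mulr0 addr0.
  by [].
have s0 : s < 0.
  have := (oriented_det 0 1 s 0 or12).1; rewrite !scale0r scale1r add0r addr0 -JE.
  by move=> /(_ or23); rewrite mul0r mul1r sub0r oppr_gt0.
have /eqP : (s - 1) * (s + 1) = 0.
  by rewrite (_ : _ * _ = s * s - 1); [rewrite s1 subrr|ring].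
rewrite mulf_eq0 subr_eq0 addr_eq0 => /orP[/eqP s1'|/eqP s1'].
  by move: s0; rewrite s1' ltNge ler01.
by rewrite JE s1' scaleN1r.
Qed.

Lemma rot_frame x (a b : R) :
  J x (a *: X1 x + b *: X2 x) = (- b) *: X1 x + a *: X2 x.
Proof.
rewrite rot_lin //; last exact: subspaceZ.
by rewrite (rotZ J b (E2 x)) rot_X2 scalerN -scaleNr addrC.
Qed.

Let X3 : vfield M := bracket X1 X2.
Let Y1 : vfield M := bracket X3 X2.
Let Y2 : vfield M := bracket X1 X3.

Definition span3 x : set (tangent x) :=
  [set v | exists a b c : R, v = a *: X1 x + (b *: X2 x + c *: X3 x)].

Fact span3_subspace x : is_subspace (@span3 x).
Proof.
split=> [|k u v [a [b [c ->]]] [a' [b' [c' ->]]]].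
  by exists 0, 0, 0; rewrite !scale0r !addr0.
exists (k * a + a'), (k * b + b'), (k * c + c').
rewrite !scalerDr !scalerDl !scalerA addrACA; congr (_ + _).
by rewrite addrACA.
Qed.

Definition span3_field : subspace_field M := SubspaceField _ span3_subspace.

Lemma span3_E x v : E x v -> span3_field x v.
Proof.
by move=> /E_span->; exists (g x v (X1 x)), (g x v (X2 x)), 0; rewrite scale0r addr0.
Qed.

Lemma span3_X3 x : span3_field x (X3 x).
Proof. by exists 0, 0, 1; rewrite !scale0r !add0r scale1r. Qed.

(** Modulo E the bracket is linear over the smooth functions. *)
Lemma span3_bracket (V : gsection E) (W : vfield M) x :
  span3_field x (bracket X1 W x) -> span3_field x (bracket X2 W x) ->
  span3_field x (bracket V W x).
Proof.
move=> S1 S2.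
pose f1 := Cinf_of (metric_smooth g V X1); pose f2 := Cinf_of (metric_smooth g V X2).
have -> : gsection_field V = vfield_comb f1 X1 (vfield_comb f2 X2 vfield_zero).
  apply: vfield_ext => y.
  rewrite -[RHS]/(g y (V y) (X1 y) *: X1 y + (g y (V y) (X2 y) *: X2 y + 0)).
  by rewrite addr0; apply: E_span; exact: gsectionP.
rewrite !bracket_comb bracket0 addr0.
have [S1' S2'] := (span3_E (E1 x), span3_E (E2 x)).
apply: subspaceD; first exact: subspaceZ.
apply: subspaceD; first exact: subspaceZ.
by apply: subspaceD; exact: subspaceZ.
Qed.

Lemma span3N x v : span3_field x v -> span3_field x (- v).
Proof. by rewrite -scaleN1r; exact: subspaceZ. Qed.

Lemma dist2_span x v : dist2 E x v <-> span3_field x v.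
Proof.
split=> [Dv|[a [b [c ->]]]].
  apply: Dv; split; first exact: span3_subspace.
  move=> _ [[V ->]|[V [W ->]]]; first by apply: span3_E; exact: gsectionP.
  have S12 : span3_field x (bracket X1 X2 x) := span3_X3 x.
  have S0 : span3_field x 0 := subspace0 span3_field x.
  by apply: span3_bracket; rewrite bracketC; apply: span3N; apply: span3_bracket;
    rewrite ?bracket_self // bracketC; exact: span3N.
have D1 : dist2 E x (X1 x) by apply: sub_lspan; left; exists X1.
have D2 : dist2 E x (X2 x) by apply: sub_lspan; left; exists X2.
have D3 : dist2 E x (X3 x) by apply: sub_lspan; right; exists X1, X2.
apply: subspaceD; first exact: subspaceZ.
by apply: subspaceD; exact: subspaceZ.
Qed.

(** E^-2 has rank three, so three fields that span it are independent. *)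
Lemma frame3_free x (a b c : R) :
  a *: X1 x + (b *: X2 x + c *: X3 x) = 0 -> [/\ a = 0, b = 0 & c = 0].
Proof.
have [e /nbhs_singleton eB] := sub3 x.
have [|v /dist2_span[a' [b' [c' ->]]]|_ free] :=
    span_is_basis (f := fun i => tnth [tuple X1 x; X2 x; X3 x] i) eB.
- move=> i; case: (unliftP ord0 i) => [j|] ->.
    case: (unliftP ord0 j) => [l|] ->.
      by rewrite (ord1 l); exact/dist2_span/span3_X3.
    exact/dist2_span/span3_E.
  exact/dist2_span/span3_E.
- exists (fun i => tnth [tuple a'; b'; c'] i).
  by rewrite !big_ord_recl big_ord0 addr0.
move=> abc0; have := free (fun i => tnth [tuple a; b; c] i).
rewrite !big_ord_recl big_ord0 addr0 => /(_ abc0) z.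
by split; [exact: (z ord0)|exact: (z (lift ord0 ord0))|
           exact: (z (lift ord0 (lift ord0 ord0)))].
Qed.

Lemma phi0_dist2 x v : dist2 E x v -> phi x v = 0.
Proof. by move=> Dv; apply/phiP.1. Qed.

Lemma phi_Y2 x : phi x (Y2 x) = X2 x.
Proof. by have := phiP.2 X1 x; rewrite X1u scale1r. Qed.

(** Since J X2 = - X1, the bracket of X2 and J X2 is again X3, and the normalization
    of phi applied to X2 gives phi [X2, X3] = J X2 = - X1. *)
Lemma phi_Y1 x : phi x (Y1 x) = X1 x.
Proof.
have := phiP.2 X2 x; have [_ _ ->] := rot_unit J (E1 x) (X1u x).
have -> : bracket X2 (rot_app J X2) = X3.
  by apply: vfield_ext => y; apply: bracket_opp => z; exact: rot_X2.
by rewrite scale1r rot_X2 bracketC phiN => /oppr_inj.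
Qed.

Lemma phi_Y x (a b : R) :
  phi x (a *: Y1 x + b *: Y2 x) = a *: X1 x + b *: X2 x.
Proof. by rewrite eform_lin phiZ phi_Y1 phi_Y2. Qed.

Lemma phi_comb x (a b : R) v : dist2 E x v ->
  phi x (v + (a *: Y1 x + b *: Y2 x)) = a *: X1 x + b *: X2 x.
Proof.
by move=> Dv; rewrite -[v]scale1r eform_lin phi0_dist2 // scaler0 add0r phi_Y.
Qed.

(** phi v = d X1 + e X2 tells which combination of Y1 and Y2 brings v into
    ker phi = E^-2. *)
Lemma frame_spans x v : exists a b c d e : R,
  v = a *: X1 x + (b *: X2 x + (c *: X3 x + (d *: Y1 x + e *: Y2 x))).
Proof.
have := E_span (eform_E phi v); move: (g x _ _) (g x _ _) => e d phiv.
have /dist2_span[a [b [c abc]]] : dist2 E x (v - (d *: Y1 x + e *: Y2 x)).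
  apply/phiP.1; rewrite -[v]scale1r eform_lin phiN phi_Y scale1r phiv.
  by rewrite subrr.
exists a, b, c, d, e; apply/eqP; rewrite !addrA -[X in _ == X + _ + _]addrA.
by rewrite -abc -addrA subrK.
Qed.

Lemma frame_free x (a b c d e : R) :
  a *: X1 x + (b *: X2 x + (c *: X3 x + (d *: Y1 x + e *: Y2 x))) = 0 ->
  [/\ a = 0, b = 0, c = 0, d = 0 & e = 0].
Proof.
rewrite !addrA -[X in X + _ + _]addrA -addrA => v0.
have D3 : dist2 E x (a *: X1 x + (b *: X2 x + c *: X3 x)).
  by apply/dist2_span; exists a, b, c.
have [d0 e0] : d = 0 /\ e = 0.
  have de0 : d *: X1 x + e *: X2 x = 0.
    by rewrite -(phi_comb d e D3) v0 phi0_dist2 //; exact: subspace0.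
  have := metric_frame x d e 1 0; have := metric_frame x d e 0 1.
  rewrite de0 !metric0l // ?mulr0 ?mulr1 ?addr0 ?add0r => <- <- //.
by move: v0; rewrite d0 e0 !scale0r !addr0 => /frame3_free[].
Qed.

Lemma adapted_frame_of_unit_section : inhabited (adapted_frame J phi).
Proof.
pose F (i : 'I_5) : vfield M :=
  tnth [tuple gsection_field X1; gsection_field X2; X3; Y1; Y2] i.
pose i0 : 'I_5 := ord0; pose i1 : 'I_5 := lift ord0 ord0.
pose i2 : 'I_5 := lift ord0 (lift ord0 ord0).
pose i3 : 'I_5 := lift ord0 (lift ord0 (lift ord0 ord0)).
pose i4 : 'I_5 := lift ord0 (lift ord0 (lift ord0 (lift ord0 ord0))).
have sumE x (a : 'I_5 -> R) : \sum_i a i *: F i x =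
    a i0 *: X1 x + (a i1 *: X2 x + (a i2 *: X3 x + (a i3 *: Y1 x + a i4 *: Y2 x))).
  by rewrite !big_ord_recl big_ord0 addr0.
have FB x : is_basis [set: tangent x] (fun i => F i x).
  split=> [v|a].
    split=> // _; have [a [b [c [d [e vE]]]]] := frame_spans v.
    by exists (tnth [tuple a; b; c; d; e]); rewrite sumE.
  rewrite sumE => /frame_free[a0 a1 a2 a3 a4] i.
  case: (unliftP ord0 i) => [j|] -> //; case: (unliftP ord0 j) => [k|] -> //.
  case: (unliftP ord0 k) => [l|] -> //; case: (unliftP ord0 l) => [m|] -> //.
  by rewrite (ord1 m).
have [e [eF eD]] := coframe_exists FB.
have expand x v : v = e i0 x v *: X1 x + (e i1 x v *: X2 x + (e i2 x v *: X3 x +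
    (e i3 x v *: Y1 x + e i4 x v *: Y2 x))).
  by rewrite -(sumE x (fun i => e i x v)); exact: eF.
have D1 x i : e i x (X1 x) = (i == i0)%:R := eD x i i0.
have D2 x i : e i x (X2 x) = (i == i1)%:R := eD x i i1.
have D3 x i : e i x (X3 x) = (i == i2)%:R := eD x i i2.
have D4 x i : e i x (Y1 x) = (i == i3)%:R := eD x i i3.
have D5 x i : e i x (Y2 x) = (i == i4)%:R := eD x i i4.
have PE x v : E x v <-> [/\ e i2 x v = 0, e i3 x v = 0 & e i4 x v = 0].
  split=> [/E_span->|[v2 v3 v4]].
    by split; rewrite form1_lin form1Z D1 D2 /= !mulr0 addr0.
  by rewrite (expand x v) v2 v3 v4 !scale0r !addr0.
have P2 x v : dist2 E x v <-> e i3 x v = 0 /\ e i4 x v = 0.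
  split=> [/dist2_span[a [b [c ->]]]|[v3 v4]].
    by split; rewrite !form1_lin form1Z D1 D2 D3 /= !mulr0 !addr0.
  apply/dist2_span; exists (e i0 x v), (e i1 x v), (e i2 x v).
  by rewrite {1}(expand x v) v3 v4 !scale0r !addr0.
have EE x v : E x v -> v = e i0 x v *: X1 x + e i1 x v *: X2 x.
  by move=> /PE[v2 v3 v4]; rewrite {1}(expand x v) v2 v3 v4 !scale0r !addr0.
have phiE x v : phi x v = e i3 x v *: X1 x + e i4 x v *: X2 x.
  rewrite {1}(expand x v) (addrA (e i1 x v *: _)) (addrA (e i0 x v *: _)).
  rewrite phi_comb //.
  by apply/dist2_span; exists (e i0 x v), (e i1 x v), (e i2 x v).
constructor.
apply: (@AdaptedFrame R n M E g o J phi X1 X2 X3 Y1 Y2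
          (e i0) (e i1) (e i2) (e i3) (e i4)) => //.
- by move=> x; rewrite bracketC.
- move=> x u v Eu Ev; rewrite {1}(EE x u Eu) {1}(EE x v Ev) rot_frame.
  by rewrite metric_frame; ring.
- move=> x u v; rewrite -[LHS]/(g x (J x (phi x u)) (phi x v)) !phiE rot_frame.
  by rewrite metric_frame; ring.
Qed.

End FrameConstruction.

(** * Existence and uniqueness of the grading *)

Theorem lemma8p1 (R : realType) (M : manifold R 5) (E : subspace_field M)
    (g : metric E) (o : orientation E) (J : rotation g o) (phi : eform E) :
  connected [set: M] ->
  growth_vector_235 E ->
  trivializable E ->
  is_phi J phi ->
  (forall I : grading M, is_egrading E I ->
     exists! theta : form1 M, is_theta J I theta) /\
  exists! I : grading M,
    [/\ is_egrading E I,
        forall (U W1 W2 : vfield M) (x : M),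
          E x (U x) -> gr3 I x (W1 x) -> gr3 I x (W2 x) ->
          d2 (Psi J phi) U W1 W2 x = 0 &
        forall theta : form1 M, is_theta J I theta ->
          forall (U W : vfield M) (x : M),
            E x (U x) ->
            (exists a b, [/\ gr2 I x a, gr3 I x b & W x = a + b]) ->
            d1 theta U W x = 0].
Proof.
move=> _ [sub2 sub3 _] triv phiP.
have [X1 X1u] := unit_section (g := g) sub2 triv.
have [fr] := adapted_frame_of_unit_section X1u sub2 sub3 phiP.
split=> [I egI|].
  exists (grading_theta fr egI); split; first exact: grading_theta_is_theta.
  by move=> theta; apply: (is_theta_uniq fr egI); exact: grading_theta_is_theta.
have egI0 := canonical_is_egrading fr (Psi J phi).
exists (canonical_grading fr (Psi J phi)); split.
  split=> // [U W1 W2 x EU|theta thetaP U W x EU].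
    exact: (canonical_psi (fr_Psi fr)).
  move=> [a [b [/gr2P[_ _ a1 a2] /gr3P[_ b1 b2] Wab]]].
  rewrite (is_theta_uniq fr egI0 thetaP (theta0_is_theta fr (Psi J phi))).
  by apply: canonical_d1_theta0; rewrite // Wab form1D ?a1 ?a2 ?b1 ?b2 addr0.
move=> I [egI condPsi condTheta].
exact: (canonical_grading_uniq (fr_Psi fr) egI condPsi condTheta).
Qed.
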